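(* Let $X\in\mathbf{Top}$. Then there are maps $\|\Lambda_\bullet X\|_1\to G_2(X)$ and $G_2(X)\to\|\Lambda_\bullet X\|_1$ which are maps over $X$ up to homotopy. That is, the composite $\|\Lambda_\bullet X\|_1\to G_2(X)\xrightarrow{p_2}X$ is homotopic to the canonical map $\|\Lambda_\bullet X\|_1\to X$, and the composite $G_2(X)\to\|\Lambda_\bullet X\|_1\to X$ of the second map with the canonical map is homotopic to $p_2$.
   Context: $\mathbf{Top}$ is the category of well-pointed compactly generated spaces having the homotopy type of CW-complexes; maps and homotopies are base-point preserving. $\Omega$ and $\Sigma$ are the loop space and reduced suspension functors, and $\mathrm{ev}_X\colon\Sigma\Omega X\to X$, $[\omega,s]\mapsto\omega(s)$, is the evaluation map. Ganea fibrations: $p_1\colon G_1(X)\to X$ is the fibration associated to $\mathrm{ev}_X\colon\Sigma\Omega X\to X$. Given $p_n\colon G_n(X)\to X$ with homotopy fiber $F_n(X)$, let $G_n(X)\cup\mathcal{C}(F_n(X))$ be the mapping cone (with reduced cone $\mathcal C$) of $F_n(X)\to G_n(X)$ and let $p'_{n+1}\colon G_n(X)\cup\mathcal C(F_n(X))\to X$ be $p_n$ on $G_n(X)$ and constant at the base point on the cone; $p_{n+1}\colon G_{n+1}(X)\to X$ is the fibration associated to $p'_{n+1}$. A facial space $X_\bullet$ is a sequence of spaces $X_0,X_1,\dots$ in $\mathbf{Top}$ with maps $d_i\colon X_n\to X_{n-1}$ ($0\le i\le n$) such that $d_id_j=d_{j-1}d_i$ for $i<j$. A facial resolution $X_\bullet\to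 X$ is a facial space together with an augmentation $d_0\colon X_0\to X$ satisfying $d_0d_0=d_0d_1$ on $X_1$. Realization: let $\Delta^n$ be the standard $n$-simplex, $\delta^i$ the inclusions of its faces, and $X\rtimes Y=X\times Y/( *\times Y)$. Set $\|X_\bullet\|_0=X_0$ with $\chi_0\colon X_0\rtimes\Delta^0\to X_0$ the obvious homeomorphism. Inductively, $\|X_\bullet\|_n$ and $\chi_n\colon X_n\rtimes\Delta^n\to\|X_\bullet\|_n$ are defined by the pushout of $X_n\rtimes\Delta^n\hookleftarrow X_n\rtimes\partial\Delta^n\xrightarrow{\varphi_n}\|X_\bullet\|_{n-1}$, where $\varphi_n\circ(X_n\rtimes\delta^i)=\chi_{n-1}\circ(d_i\rtimes\Delta^{n-1})$ for $0\le i\le n$. For a facial resolution $X_\bullet\to X$, the canonical map $\|X_\bullet\|_n\to X$ is the augmentation for $n=0$; for $n\geq 1$ it is the unique map extending the canonical map on $\|X_\bullet\|_{n-1}$ whose composite with $\chi_n$ is $X_n\rtimes\Delta^n\xrightarrow{\mathrm{pr}}X_n\xrightarrow{(d_0)^{n+1}}X$. $\Lambda_\bullet X\to X$ is the facial resolution with $\Lambda_nX=(\Sigma\Omega)^{n+1}X$, face operators $d_i=(\Sigma\Omega)^i(\mathrm{ev}_{(\Sigma\Omega)^{n-i}X})\colon(\Sigma\Omega)^{n+1}X\to(\Sigma\Omega)^nX$, and augmentation $d_0=\mathrm{ev}_X\colon\Sigma\Omega X\to X$. *)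

(* Defs.v *)
From HB Require Import structures.
From Stdlib Require Import Relation_Operators.
From mathcomp Require Import all_boot all_order all_algebra generic_quotient.
From mathcomp Require Import all_classical reals topology normedtype.
From mathcomp Require Import continuous_path.

Set Implicit Arguments.
Unset Strict Implicit.
Unset Printing Implicit Defensive.

Import Order.TTheory GRing.Theory Num.Theory.
Import numFieldNormedType.Exports.

Local Open Scope classical_set_scope.
Local Open Scope ring_scope.

HB.instance Definition _ (X Y : ptopologicalType) := Pointed.on (X * Y)%type.

Record ptmap (X Y : ptopologicalType) := PtMap {
  pfun :> X -> Y;
  pfun_cts : continuous pfun;
  pfun_pt : pfun point = point }.
Arguments pfun_cts {X Y} _ _.
Arguments pfun_pt {X Y} _.

Lemma ptcomp_cts (X Y Z : ptopologicalType) (g : ptmap Y Z) (f : ptmap X Y) :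
  continuous (g \o f).
Proof.
by move=> x; apply: continuous_comp; exact: pfun_cts.
Qed.

Arguments ptcomp_cts {X Y Z} g f _.

Lemma ptcomp_pt (X Y Z : ptopologicalType) (g : ptmap Y Z) (f : ptmap X Y) :
  (g \o f) point = point.
Proof. by rewrite /= !pfun_pt. Qed.

Definition ptcomp (X Y Z : ptopologicalType) (g : ptmap Y Z) (f : ptmap X Y) :
  ptmap X Z := PtMap (ptcomp_cts g f) (ptcomp_pt g f).

Lemma pair_continuous (Z X Y : topologicalType) (f : Z -> X) (g : Z -> Y) :
  continuous f -> continuous g -> continuous (fun z => (f z, g z)).
Proof. by move=> cf cg z; apply: cvg_pair; [exact: cf|exact: cg]. Qed.

Section Interval.
Context {R : realType}.

Definition I01 : Type := set_type (`[0, 1]%classic : set R).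
HB.instance Definition _ := Topological.on I01.

Lemma I01_zero_subproof : (0 : R) \in (`[0, 1]%classic : set R).
Proof. by rewrite inE /= in_itv /= lexx ler01. Qed.
Lemma I01_one_subproof : (1 : R) \in (`[0, 1]%classic : set R).
Proof. by rewrite inE /= in_itv /= lexx ler01. Qed.
Definition I01_zero : I01 := exist _ 0 I01_zero_subproof.
Definition I01_one : I01 := exist _ 1 I01_one_subproof.
Lemma I01_neq : I01_zero != I01_one.
Proof. by apply/eqP => /(congr1 val) /= /eqP; rewrite eq_sym oner_eq0. Qed.

HB.instance Definition _ := isBiPointed.Build I01 I01_neq.
HB.instance Definition _ := isPointed.Build I01 I01_zero.

Lemma I01_val_continuous : continuous (val : I01 -> R).
Proof. exact: (@initial_continuous _ _ (set_val : I01 -> R)). Qed.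

Lemma I01_compact : compact [set: I01].
Proof.
move=> F FF _.
have F01 : ((val : I01 -> R) @ F) `[0, 1]%classic.
  by apply: (@filterS _ F _ setT) => [[x hx] _|]; [exact: set_mem hx|exact: filterT].
have [p [p01 clp]] := @segment_compact R 0 1 _ _ F01.
exists (exist _ p (mem_set p01)); split=> //.
move=> B C FB [_ [[W oW <-] /= Wp WC]].
have [|_ [[x Bx <-] Wx]] := clp (val @` B) W _ (open_nbhs_nbhs (conj oW Wp)).
  by apply: (@filterS _ F _ B) => // x Bx; exists x.
by exists x; split=> //; exact: WC.
Qed.

Lemma I01_hausdorff : hausdorff_space I01.
Proof.
move=> p q pq; apply/val_inj/(@norm_hausdorff R R) => A B nA nB.
have nA' : nbhs p (val @^-1` A) by apply: I01_val_continuous; exact: nA.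
have nB' : nbhs q (val @^-1` B) by apply: I01_val_continuous; exact: nB.
by have [x [? ?]] := pq _ _ nA' nB'; exists (val x).
Qed.

End Interval.
Arguments I01 R : clear implicits.

Lemma I01_locally_compact (R : realType) : locally_compact [set: I01 R].
Proof.
move=> x _; rewrite withinET; exists setT; first exact: filterT.
by split; [exact: I01_compact|exact: closedT].
Qed.

Lemma path_eval_continuous (R : realType) (T X : topologicalType)
    (c : T -> {compact-open, I01 R -> X}) :
  continuous c -> (forall t, continuous (c t : I01 R -> X)) ->
  continuous (fun p : T * I01 R => (c p.1 : I01 R -> X) p.2).
Proof.
move=> cc cct.
have <- : uncurry (c : T -> I01 R -> X) =
    (fun p : T * I01 R => (c p.1 : I01 R -> X) p.2) by apply/funext => -[].
exact: (@continuous_uncurry T (I01 R) X c (@I01_locally_compact R)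
  I01_hausdorff cc cct).
Qed.

Lemma postcomp_continuous (K X Y : topologicalType) (f : X -> Y) :
  continuous f ->
  continuous ((fun g => f \o g) : {compact-open, K -> X} -> {compact-open, K -> Y}).
Proof.
move=> cf g; apply/compact_open_cvgP; first by apply: fmap_filter; exact: nbhs_filter.
move=> C O cC oO fgO.
have oP : open (f @^-1` O) by apply: open_comp => // x _; exact: cf.
have : open_nbhs g [set h : {compact-open, K -> X} | h @` C `<=` f @^-1` O].
  split; first exact: compact_open_open.
  by move=> _ [x Cx <-]; apply: fgO; exists x.
move/open_nbhs_nbhs; apply: filterS => h hO _ [x Cx <-].
by apply: hO; exists x.
Qed.

(** Test maps from compact Hausdorff spaces are used throughout. [in_Top] below
    requires both this property and [weak_hausdorff], which is the usual meaning
    of a compactly generated space. *)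
Definition compactly_generated (X : topologicalType) : Prop :=
  forall U : set X,
    (forall (K : topologicalType) (f : K -> X),
       compact [set: K] -> hausdorff_space K -> continuous f ->
       open (f @^-1` U)) ->
    open U.

Definition weak_hausdorff (X : topologicalType) : Prop :=
  forall (K : topologicalType) (f : K -> X),
    compact [set: K] -> hausdorff_space K -> continuous f -> closed (range f).

(** The compactly generated refinement of a topology. Mapping spaces, fibre
    products and subspaces are formed in compactly generated spaces by applying
    it to the usual construction. Quotients, sums and products with a compact
    Hausdorff space (interval, simplex) of compactly generated spaces are already
    compactly generated, so there the usual topology is the right one. *)
Definition kify (T : Type) : Type := T.

Section Kify.
Context {T : topologicalType}.

Definition kopen (U : set (kify T)) : Prop :=
  forall (K : topologicalType) (f : K -> T),
    compact [set: K] -> hausdorff_space K -> continuous f -> open (f @^-1` U).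

Lemma kopenT : kopen setT.
Proof. by move=> K f _ _ _; rewrite preimage_setT; exact: openT. Qed.

Lemma kopenI : setI_closed kopen.
Proof.
by move=> A B kA kB K f cK hK cf; rewrite preimage_setI; apply: openI;
  [exact: kA|exact: kB].
Qed.

Lemma kopen_bigU (I : Type) (F : I -> set (kify T)) :
  (forall i, kopen (F i)) -> kopen (\bigcup_i F i).
Proof.
move=> kF K f cK hK cf; rewrite preimage_bigcup; apply: bigcup_open => i _.
exact: kF.
Qed.

HB.instance Definition _ := Choice.on (kify T).
HB.instance Definition _ :=
  isOpenTopological.Build (kify T) kopenT kopenI kopen_bigU.

Lemma kify_openE (U : set (kify T)) : open U = kopen U.
Proof. by []. Qed.

Lemma unkify_continuous : continuous (idfun : kify T -> T).
Proof.
apply/continuousP => A oA; rewrite kify_openE => K f _ _ cf.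
by apply: open_comp => // x _; exact: cf.
Qed.
End Kify.

HB.instance Definition _ (T : ptopologicalType) :=
  isPointed.Build (kify T) (point : T).

Lemma kify_continuous (S T : topologicalType) (f : S -> T) :
  continuous f -> continuous (f : kify S -> kify T).
Proof.
move=> cf; apply/continuousP => A; rewrite !kify_openE => kA K g cK hK cg.
apply: (kA K (f \o g)) => // x; apply: continuous_comp; [exact: cg|exact: cf].
Qed.

Section Quot.
Variables (T : ptopologicalType) (r : T -> T -> Prop).

Definition eqv_gen : rel T := fun x y => `[< clos_refl_sym_trans T r x y >].

Lemma eqv_gen_refl : reflexive eqv_gen.
Proof. by move=> x; apply/asboolP; exact: rst_refl. Qed.

Lemma eqv_gen_sym : symmetric eqv_gen.
Proof. by move=> x y; apply/asboolP/asboolP; exact: rst_sym. Qed.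

Lemma eqv_gen_trans : transitive eqv_gen.
Proof.
by move=> y x z /asboolP xy /asboolP yz; apply/asboolP; exact: (rst_trans _ _ _ y).
Qed.

Canonical eqv_gen_equiv := EquivRel eqv_gen eqv_gen_refl eqv_gen_sym eqv_gen_trans.

(** Quotient by the equivalence relation generated by [r]; the base point is the
    class of the base point. *)
Definition quot : ptopologicalType :=
  quotient_topology {eq_quot eqv_gen_equiv}%qT.

Definition qpi : T -> quot := \pi_(quotient_topology {eq_quot eqv_gen_equiv})%qT.

Lemma qpi_continuous : continuous qpi.
Proof. exact: pi_continuous. Qed.

Lemma qpi_eq x y : r x y -> qpi x = qpi y.
Proof. by move=> rxy; apply/eqmodP/asboolP; exact: rst_step. Qed.

Definition qlift (Z : Type) (f : T -> Z) : quot -> Z :=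
  f \o (repr : quotient_topology {eq_quot eqv_gen_equiv} -> T)%qT.

Section Lift.
Variables (Z : topologicalType) (f : T -> Z).
Hypothesis fr : forall x y, r x y -> f x = f y.

Lemma clos_fr x y : clos_refl_sym_trans T r x y -> f x = f y.
Proof. by elim=> [a b /fr|//|a b _ ->|a b c _ -> _ ->]. Qed.

Lemma qliftE x : qlift f (qpi x) = f x.
Proof.
rewrite /qlift /=.
have /eqmodP/asboolP :
    (repr (qpi x : {eq_quot eqv_gen_equiv}) = x %[mod {eq_quot eqv_gen_equiv}])%qT.
  exact: reprK.
exact: clos_fr.
Qed.

Lemma qlift_continuous : continuous f -> continuous (qlift f).
Proof.
move=> cf; apply/quotient_continuous.
by rewrite (_ : _ \o _ = f)//; apply/funext => x /=; exact: qliftE.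
Qed.
End Lift.

Lemma quot_ind (P : quot -> Prop) : (forall x, P (qpi x)) -> forall q, P q.
Proof.
move=> Pq q; have <- : qpi (repr (q : quotient_topology {eq_quot eqv_gen_equiv}))%qT = q.
  exact: reprK.
exact: Pq.
Qed.
End Quot.

Section QuotMap.
Variables (T : ptopologicalType) (r : T -> T -> Prop) (Z : ptopologicalType).
Variables (f : T -> Z) (fr : forall x y, r x y -> f x = f y).
Hypotheses (cf : continuous f) (f0 : f point = point).

Lemma qmap_pt : qlift f (point : quot r) = point.
Proof. by rewrite -[LHS]/(qlift f (qpi r point)) qliftE. Qed.

Definition qmap : ptmap (quot r) Z := PtMap (qlift_continuous fr cf) qmap_pt.
End QuotMap.

(** [T / A]; only used when [A] contains the base point of [T]. *)
Definition collapse (T : ptopologicalType) (A : set T) : ptopologicalType :=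
  quot (fun x y => A x /\ A y).

Definition psub (T : ptopologicalType) (A : set T) (h : A point) : Type :=
  set_type A.

Section Psub.
Variables (T : ptopologicalType) (A : set T) (h : A point).
HB.instance Definition _ := Topological.on (psub h).
HB.instance Definition _ :=
  isPointed.Build (psub h) (exist _ point (mem_set h)).
End Psub.

Section Attach.
Variables X Y : ptopologicalType.

Definition sum_fam (b : bool) : topologicalType := if b then X else Y.

Definition psum : Type := {b : bool & sum_fam b}.
HB.instance Definition _ := Topological.on psum.
HB.instance Definition _ := isPointed.Build psum (existT sum_fam true point).

Definition in1 (x : X) : psum := existT sum_fam true x.
Definition in2 (y : Y) : psum := existT sum_fam false y.

Lemma in1_continuous : continuous in1.
Proof. exact: (@existT_continuous _ sum_fam true). Qed.

Lemma in2_continuous : continuous in2.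
Proof. exact: (@existT_continuous _ sum_fam false). Qed.

Definition sum_map (Z : Type) (f : X -> Z) (g : Y -> Z) (p : psum) : Z :=
  (if projT1 p as b return sum_fam b -> Z then f else g) (projT2 p).

Lemma sum_map_continuous (Z : topologicalType) (f : X -> Z) (g : Y -> Z) :
  continuous f -> continuous g -> continuous (sum_map f g).
Proof.
move=> cf cg.
by move=> [[] x] U; [exact: cf|exact: cg].
Qed.

(** Pushout of a span [X <- C -> Y] with legs [f], [g], encoded by the relation
    [r x y := exists c, x = f c /\ y = g c]. The base point is that of [X]. *)
Definition attach (r : X -> Y -> Prop) : ptopologicalType :=
  quot (fun p q : psum => exists x y, [/\ r x y, p = in1 x & q = in2 y]).

Variable r : X -> Y -> Prop.
Definition att1 : X -> attach r := qpi _ \o in1.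
Definition att2 : Y -> attach r := qpi _ \o in2.

Lemma att1_continuous : continuous att1.
Proof.
by move=> x; apply: continuous_comp; [exact: in1_continuous|exact: qpi_continuous].
Qed.

Lemma att2_continuous : continuous att2.
Proof.
by move=> x; apply: continuous_comp; [exact: in2_continuous|exact: qpi_continuous].
Qed.

Lemma att_glue x y : r x y -> att1 x = att2 y.
Proof. by move=> rxy; apply: qpi_eq; exists x, y. Qed.

Definition att1_ptmap : ptmap X (attach r) := PtMap att1_continuous erefl.

Section Lift.
Variables (Z : ptopologicalType) (f : ptmap X Z) (g : Y -> Z).
Hypotheses (cg : continuous g) (fg : forall x y, r x y -> f x = g y).

Lemma att_lift_compat p q :
  (exists x y, [/\ r x y, p = in1 x & q = in2 y]) -> sum_map f g p = sum_map f g q.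
Proof. by move=> [x [y [/fg rxy -> ->]]]. Qed.

Definition att_lift : ptmap (attach r) Z :=
  qmap att_lift_compat (sum_map_continuous (pfun_cts f) cg) (pfun_pt f).

Lemma att_lift1 x : att_lift (att1 x) = f x.
Proof. exact: (qliftE att_lift_compat). Qed.

Lemma att_lift2 y : att_lift (att2 y) = g y.
Proof. exact: (qliftE att_lift_compat). Qed.
End Lift.
End Attach.

Section Homotopy.
Variable R : realType.

Definition homotopic (X Y : topologicalType) (f g : X -> Y) : Prop :=
  exists H : X * I01 R -> Y,
    [/\ continuous H, forall x, H (x, zero) = f x & forall x, H (x, one) = g x].

(** For compactly generated [X] the product with the interval is the usual one. *)
Definition phomotopic (X Y : ptopologicalType) (f g : ptmap X Y) : Prop :=
  exists H : X * I01 R -> Y,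
    [/\ continuous H, forall x, H (x, zero) = f x, forall x, H (x, one) = g x
      & forall t, H (point, t) = point].

(** The inclusion of the base point is a (Hurewicz) cofibration. It is a closed
    one in a weak Hausdorff space. *)
Definition well_pointed (X : ptopologicalType) : Prop :=
  forall (Y : topologicalType) (f : X -> Y) (h : I01 R -> Y),
    continuous f -> continuous h -> h zero = f point ->
    exists H : X * I01 R -> Y,
      [/\ continuous H, forall x, H (x, zero) = f x
        & forall t, H (point, t) = h t].

Definition sqnorm n (v : 'rV[R]_n) : R := \sum_i v ord0 i ^+ 2.

Definition disk n : topologicalType :=
  set_type [set v : 'rV[R]_n | sqnorm v <= 1].

Definition disk_interior n : set (disk n) := [set v | sqnorm (val v) < 1].
Definition disk_boundary n : set (disk n) := [set v | sqnorm (val v) = 1].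

(** Whitehead's definition through characteristic maps: the open cells partition
    [K] and are parametrised injectively, cell boundaries are covered by finitely
    many open cells of lower dimension, and [K] has the weak topology. That each
    [Phi e] is a homeomorphism from the open disk onto its image follows by
    compactness of the disk. *)
Definition is_CW_complex (K : topologicalType) : Prop :=
  hausdorff_space K /\
  exists (cell : Type) (dim : cell -> nat) (Phi : forall e, disk (dim e) -> K),
    [/\ forall e, continuous (Phi e),
        forall x, exists e v, @disk_interior (dim e) v /\ Phi e v = x,
        forall e e' v v',
          @disk_interior (dim e) v -> @disk_interior (dim e') v' ->
          Phi e v = Phi e' v' ->
          existT (fun e => disk (dim e)) e v = existT _ e' v',
        forall e, exists m (s : 'I_m -> cell),
          (forall k, dim (s k) < dim e)%N /\
          forall v, @disk_boundary (dim e) v -> exists k w,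
            @disk_interior (dim (s k)) w /\ Phi e v = Phi (s k) w
      & forall A : set K,
          (forall e, closed (Phi e @^-1` A)) -> closed A].

(** Free homotopy equivalence; for well-pointed spaces this agrees with pointed
    homotopy equivalence to a CW complex pointed at a vertex. *)
Definition has_CW_homotopy_type (X : topologicalType) : Prop :=
  exists K : topologicalType, is_CW_complex K /\
  exists (f : X -> K) (g : K -> X),
    [/\ continuous f, continuous g, homotopic (g \o f) idfun
      & homotopic (f \o g) idfun].

Record in_Top (X : ptopologicalType) : Prop := InTop {
  Top_cg : compactly_generated X;
  Top_wh : weak_hausdorff X;
  Top_wp : well_pointed X;
  Top_CW : has_CW_homotopy_type X }.

End Homotopy.

Section LoopSusp.
Variable R : realType.

Notation I := (I01 R).
Notation path X := {path I from (point : X) to (point : X) in X}.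

HB.instance Definition _ (X : ptopologicalType) :=
  isPointed.Build (path X) (cst point : path X).

Definition Om (X : ptopologicalType) : ptopologicalType := kify (path X).

Definition Sg (X : ptopologicalType) : ptopologicalType :=
  @collapse (X * I)%type
    [set p | p.1 = point \/ p.2 = zero \/ p.2 = one].

(** [[x, t]] *)
Definition sg (X : ptopologicalType) : X * I -> Sg X := qpi _.

Lemma Sg_ind (X : ptopologicalType) (P : Sg X -> Prop) :
  (forall x t, P (sg (x, t))) -> forall q, P q.
Proof. by move=> H; apply: quot_ind => -[x t]; exact: H. Qed.

Section Functoriality.
Variables (X Y : ptopologicalType) (f : ptmap X Y).

Lemma Om_cts (w : path X) : continuous (f \o w).
Proof. by move=> t; apply: continuous_comp; [exact: cts_fun|exact: pfun_cts]. Qed.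

Lemma Om_zero (w : path X) : (f \o w) zero = point.
Proof. by rewrite /= path_zero pfun_pt. Qed.

Lemma Om_one (w : path X) : (f \o w) one = point.
Proof. by rewrite /= path_one pfun_pt. Qed.

Definition Om_fun (w : path X) : path Y :=
  mk_path (@Om_cts w) (Om_zero w) (Om_one w).

Lemma Om_fun_continuous : continuous (Om_fun : Om X -> Om Y).
Proof.
apply: kify_continuous; apply: continuous_comp_initial => w.
apply: (@continuous_comp _ _ _ (fun w : path X => (w : {compact-open, I -> X}))
  (fun g : {compact-open, I -> X} => (f \o g : {compact-open, I -> Y}))).
  exact: initial_continuous.
exact: postcomp_continuous (pfun_cts f) _.
Qed.

Lemma Om_fun_pt : Om_fun (point : Om X) = (point : Om Y).
Proof. by apply/path_eqP => t /=; exact: pfun_pt. Qed.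

Definition Om_map : ptmap (Om X) (Om Y) := PtMap Om_fun_continuous Om_fun_pt.

Definition Sg_fun (p : X * I) : Sg Y := sg (f p.1, p.2).

Lemma Sg_fun_continuous : continuous Sg_fun.
Proof.
move=> p; apply: (@continuous_comp _ _ _ (fun p : X * I => (f p.1, p.2)) (@sg Y)).
  apply: (@pair_continuous _ _ _ (fun p : X * I => f p.1) snd) => q.
    by apply: (@continuous_comp _ _ _ fst f); [exact: cvg_fst|exact: pfun_cts].
  exact: cvg_snd.
exact: qpi_continuous.
Qed.

Lemma Sg_fun_compat (p q : X * I) :
  (p.1 = point \/ p.2 = zero \/ p.2 = one) /\
  (q.1 = point \/ q.2 = zero \/ q.2 = one) -> Sg_fun p = Sg_fun q.
Proof.
move=> [hp hq]; apply: qpi_eq; split=> /=.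
  by case: hp => [->|?]; [left; exact: pfun_pt|right].
by case: hq => [->|?]; [left; exact: pfun_pt|right].
Qed.

Lemma Sg_fun_pt : Sg_fun point = point.
Proof. by rewrite /Sg_fun /= pfun_pt. Qed.

Definition Sg_map : ptmap (Sg X) (Sg Y) :=
  qmap Sg_fun_compat Sg_fun_continuous Sg_fun_pt.

Lemma Sg_mapE x t : Sg_map (sg (x, t)) = sg (f x, t).
Proof. exact: (qliftE Sg_fun_compat). Qed.
End Functoriality.

Definition SO (X : ptopologicalType) : ptopologicalType := Sg (Om X).

Definition SO_map (X Y : ptopologicalType) (f : ptmap X Y) : ptmap (SO X) (SO Y) :=
  Sg_map (Om_map f).

Section Evaluation.
Variable X : ptopologicalType.

Definition ev_fun (p : Om X * I) : X := (p.1 : path X) p.2.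

Lemma ev_fun_continuous : continuous ev_fun.
Proof.
apply: (@path_eval_continuous R (Om X) X
  (fun w : Om X => ((w : path X) : {compact-open, I -> X}))) => [w|w].
  apply: (@continuous_comp _ _ _ (idfun : Om X -> path X)
    (fun w : path X => (w : {compact-open, I -> X}))).
    exact: unkify_continuous.
  exact: initial_continuous.
exact: (@cts_fun _ _ (w : path X)).
Qed.

Lemma ev_fun_compat (p q : Om X * I) :
  (p.1 = point \/ p.2 = zero \/ p.2 = one) /\
  (q.1 = point \/ q.2 = zero \/ q.2 = one) -> ev_fun p = ev_fun q.
Proof.
have H (s : Om X * I) : s.1 = point \/ s.2 = zero \/ s.2 = one -> ev_fun s = point.
  rewrite /ev_fun; case: s => w t /= [->//|[->|->]]; first exact: path_zero.
  exact: path_one.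
by move=> [/H -> /H ->].
Qed.

Definition ev : ptmap (SO X) X :=
  @qmap (Om X * I)%type _ X ev_fun ev_fun_compat ev_fun_continuous erefl.

Lemma evE w t : ev (sg (w, t)) = (w : path X) t.
Proof. exact: (qliftE ev_fun_compat). Qed.
End Evaluation.

Lemma ev_natural (X Y : ptopologicalType) (f : ptmap X Y) (x : SO X) :
  ev Y (SO_map f x) = f (ev X x).
Proof. by move: x; apply: Sg_ind => w t; rewrite Sg_mapE !evE. Qed.

Lemma SO_map_eq (X Y : ptopologicalType) (f g : ptmap X Y) :
  f =1 g -> SO_map f =1 SO_map g.
Proof.
move=> fg; apply: Sg_ind => w t; rewrite !Sg_mapE.
suff -> : Om_map f w = Om_map g w by [].
by apply/path_eqP => s; exact: fg.
Qed.

Lemma SO_map_comp (X Y Z : ptopologicalType) (g : ptmap Y Z) (f : ptmap X Y) x :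
  SO_map (ptcomp g f) x = SO_map g (SO_map f x).
Proof.
move: x; apply: Sg_ind => w t; rewrite [SO_map f _]Sg_mapE !Sg_mapE.
suff -> : Om_map (ptcomp g f) w = Om_map g (Om_map f w) by [].
exact/path_eqP.
Qed.

Section PathFibration.
Variables (A X : ptopologicalType) (f : ptmap A X).

(** [X^I], compact-open *)
Definition fpath : Type := continuousType I X.
HB.instance Definition _ := Choice.on fpath.
HB.instance Definition _ := Topological.copy fpath
  (initial_topology (fun w : fpath => (w : {compact-open, I -> X}))).
HB.instance Definition _ :=
  isPointed.Build fpath (cst (point : X) : continuousType I X).

(** The fibration associated to [f]: pairs of [a : A] and a path starting at
    [f a], projected to the end point of the path. *)
Definition fib_set : set (A * fpath) :=
  [set p | f p.1 = (p.2 : continuousType I X) zero].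

Lemma fib_set_pt : fib_set point.
Proof. exact: pfun_pt. Qed.

Definition fib_total : ptopologicalType := kify (psub fib_set_pt).

Definition fib_fun (p : fib_total) : X :=
  ((val (p : psub fib_set_pt)).2 : continuousType I X) one.

Lemma fib_fun_continuous : continuous fib_fun.
Proof.
pose c (p : fib_total) : {compact-open, I -> X} :=
  ((val (p : psub fib_set_pt)).2 : continuousType I X).
have cc : continuous c.
  move=> p; apply: (@continuous_comp fib_total (psub fib_set_pt) _ idfun
    (fun p => ((val p).2 : continuousType I X) : {compact-open, I -> X})).
    exact: unkify_continuous.
  apply: (@continuous_comp (psub fib_set_pt) (A * fpath)%type _ val
    (fun p => (p.2 : continuousType I X) : {compact-open, I -> X})).
    exact: (@initial_continuous _ _ (set_val : fib_set -> _)).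
  apply: (@continuous_comp (A * fpath)%type fpath _ snd
    (fun p => (p : continuousType I X) : {compact-open, I -> X})).
    exact: cvg_snd.
  exact: initial_continuous.
have := @path_eval_continuous R _ _ c cc
  (fun p => @cts_fun _ _ ((val (p : psub fib_set_pt)).2 : continuousType I X)).
move=> ce p; apply: (@continuous_comp _ _ _ (fun p : fib_total => (p, one : I))
  (fun p => (c p.1 : I -> X) p.2)); last exact: ce.
apply: (@pair_continuous fib_total fib_total I idfun (fun _ => one)) => q.
  exact: cvg_id.
exact: cst_continuous.
Qed.

Definition fib_proj : ptmap fib_total X := @PtMap fib_total X _ fib_fun_continuous erefl.
End PathFibration.

Section Fiber.
Variables (G X : ptopologicalType) (p : ptmap G X).

(** The fibre over the base point. It is applied to Ganea's maps, which are
    fibrations, so that it is a model of their homotopy fibre; moreover, [p] is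
    then strictly constant on it, as the extension of [p] to the mapping cone by a
    constant map requires. *)
Definition fiber : ptopologicalType :=
  kify (@psub G [set g | p g = point] (pfun_pt p)).

Definition fiber_incl_fun (g : fiber) : G :=
  val (g : @psub G [set g | p g = point] (pfun_pt p)).

Lemma fiber_incl_continuous : continuous fiber_incl_fun.
Proof.
move=> g; apply: (@continuous_comp fiber
  (@psub G [set g | p g = point] (pfun_pt p)) _ idfun val).
  exact: unkify_continuous.
exact: (@initial_continuous _ _ (set_val : [set g | p g = point] -> _)).
Qed.

Definition fiber_incl : ptmap fiber G :=
  @PtMap fiber G fiber_incl_fun fiber_incl_continuous erefl.

Lemma fiber_inclP g : p (fiber_incl g) = point.
Proof. by case: g => g /= gp; exact: set_mem gp. Qed.
End Fiber.

Definition cone (F : ptopologicalType) : ptopologicalType :=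
  @collapse (F * I)%type [set p | p.1 = point \/ p.2 = one].

(** [[a, t]]; the base of the cone is at [t = 0] and its vertex at [t = 1]. *)
Definition cn (F : ptopologicalType) : F * I -> cone F := qpi _.

Definition mcone (F G : ptopologicalType) (f : ptmap F G) : ptopologicalType :=
  @attach G (cone F) (fun g c => exists a, g = f a /\ c = cn (a, zero)).

Section GaneaStep.
Variables (G X : ptopologicalType) (p : ptmap G X).

Lemma ganea_step_compat (g : G) (c : cone (fiber p)) :
  (exists a, g = fiber_incl p a /\ c = cn (a, zero)) -> p g = point.
Proof. by move=> [a [-> _]]; exact: fiber_inclP. Qed.

Definition ganea_cone_map : ptmap (mcone (fiber_incl p)) X :=
  att_lift (g := fun _ => point) (fun x => @cvg_cst _ _ _ _ _) ganea_step_compat.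
End GaneaStep.

(** [ganea_from1 X n] is [p_(n+1) : G_(n+1)(X) -> X]. *)
Fixpoint ganea_from1 (X : ptopologicalType) (n : nat) :
    {G : ptopologicalType & ptmap G X} :=
  match n with
  | 0 => existT (fun G => ptmap G X) _ (fib_proj (ev X))
  | n.+1 =>
      existT (fun G => ptmap G X) _
        (fib_proj (ganea_cone_map (projT2 (ganea_from1 X n))))
  end.

(** [G_n(X)] and [p_n], for [n >= 1]. *)
Definition ganea (X : ptopologicalType) (n : nat) : ptopologicalType :=
  projT1 (ganea_from1 X n.-1).
Definition ganea_proj (X : ptopologicalType) (n : nat) : ptmap (ganea X n) X :=
  projT2 (ganea_from1 X n.-1).

End LoopSusp.

Section Simplex.
Variable R : realType.

Definition simplex_set n : set 'rV[R]_n.+1 :=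
  [set t | (forall i, 0 <= t ord0 i) /\ \sum_i t ord0 i = 1].

Definition simplex n : Type := set_type (@simplex_set n).
HB.instance Definition _ n := Topological.on (simplex n).

Lemma vertex_subproof n : simplex_set (delta_mx ord0 ord0 : 'rV[R]_n.+1).
Proof.
split=> [i|]; first by rewrite mxE; case: (_ && _).
rewrite (bigD1 ord0) //= big1 ?addr0 ?mxE ?eqxx // => i i0.
by rewrite mxE (negbTE i0) andbF.
Qed.

Definition vertex n : simplex n :=
  exist (fun t => t \in @simplex_set n) _ (mem_set (vertex_subproof n)).

(** An auxiliary base point; simplices are used unpointed. *)
HB.instance Definition _ n := isPointed.Build (simplex n) (vertex n).

Definition coface_row n (i : 'I_n.+2) (t : 'rV[R]_n.+1) : 'rV[R]_n.+2 :=
  \row_j (if unlift i j is Some k then t ord0 k else 0).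

Lemma coface_subproof n (i : 'I_n.+2) (t : simplex n) :
  simplex_set (coface_row i (val t)).
Proof.
case: t => t /= /set_mem [t0 t1]; split=> [j|].
  by rewrite mxE; case: unliftP.
rewrite (bigD1_ord i) //= mxE unlift_none add0r -[RHS]t1.
by apply: eq_bigr => k _; rewrite mxE liftK.
Qed.

Definition coface n (i : 'I_n.+2) (t : simplex n) : simplex n.+1 :=
  exist (fun t => t \in @simplex_set n.+1) _ (mem_set (coface_subproof i t)).

End Simplex.
Arguments simplex R n : clear implicits.

(** The half-smash product of [X] and [Y]; the base point of [Y] plays no role. *)
Definition hsmash (X Y : ptopologicalType) : ptopologicalType :=
  @collapse (X * Y)%type [set p | p.1 = point].

Definition hs (X Y : ptopologicalType) : X * Y -> hsmash X Y := qpi _.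

Section HsmashMap.
Variables (X Y Z : ptopologicalType) (f : ptmap X Z).

Lemma hs_pr_compat (p q : X * Y) : p.1 = point /\ q.1 = point -> f p.1 = f q.1.
Proof. by move=> [-> ->]. Qed.

Lemma hs_pr_continuous : continuous (fun p : X * Y => f p.1).
Proof.
by move=> p; apply: (@continuous_comp _ _ _ fst f); [exact: cvg_fst|exact: pfun_cts].
Qed.

Definition hs_pr : ptmap (hsmash X Y) Z :=
  @qmap (X * Y)%type _ Z _ hs_pr_compat hs_pr_continuous (pfun_pt f).

Lemma hs_prE x y : hs_pr (hs (x, y)) = f x.
Proof. exact: (qliftE hs_pr_compat). Qed.
End HsmashMap.

Lemma hs_pt (X Y : ptopologicalType) (y : Y) : hs (point : X, y) = point.
Proof. exact: qpi_eq. Qed.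

Lemma hsmash_ind (X Y : ptopologicalType) (P : hsmash X Y -> Prop) :
  (forall x y, P (hs (x, y))) -> forall q, P q.
Proof. by move=> H; apply: quot_ind => -[x y]; exact: H. Qed.

(** [fs_d n i] is [d_i : X_(n+1) -> X_n]. *)
Record facial_space := FacialSpace {
  fs_space :> nat -> ptopologicalType;
  fs_d : forall n, 'I_n.+2 -> ptmap (fs_space n.+1) (fs_space n);
  fs_dd : forall n i j, (i < j <= n.+2)%N -> forall x : fs_space n.+2,
    fs_d (inord i : 'I_n.+2) (fs_d (inord j : 'I_n.+3) x) =
    fs_d (inord j.-1 : 'I_n.+2) (fs_d (inord i : 'I_n.+3) x) }.

Record facial_resolution (X : ptopologicalType) := FacialResolution {
  fr_space :> facial_space;
  fr_aug : ptmap (fr_space 0) X;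
  fr_augd : forall x : fr_space 1,
    fr_aug (fs_d fr_space (inord 0 : 'I_2) x) =
    fr_aug (fs_d fr_space (inord 1 : 'I_2) x) }.

Section Realization.
Variable R : realType.

Section FacialSpace.
Variable A : facial_space.

(** [||A||_n] together with [chi_n]. *)
Definition stage n := {T : ptopologicalType & ptmap (hsmash (A n) (simplex R n)) T}.

Section Step.
Variables (n : nat) (S : stage n).

(** The identifications along [phi_(n+1)]: the points of the half-smash of
    [A (n.+1)] with the boundary of the simplex are the [[a, coface i t]], and
    [phi_(n+1)] maps such a point to [chi_n [d_i a, t]]. *)
Definition glue_rel (x : projT1 S) (y : hsmash (A n.+1) (simplex R n.+1)) : Prop :=
  exists (i : 'I_n.+2) (a : A n.+1) (t : simplex R n),
    x = projT2 S (hs (fs_d A i a, t)) /\ y = hs (a, coface i t).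

Lemma chi_pt : att2 glue_rel point = point.
Proof.
rewrite -(hs_pt _ (coface ord0 (vertex R n))).
rewrite -(@att_glue _ _ glue_rel point) //.
by exists ord0, point, (vertex R n); rewrite pfun_pt hs_pt pfun_pt.
Qed.

Definition step : stage n.+1 :=
  existT (fun T => ptmap _ T) (attach glue_rel)
    (PtMap (@att2_continuous _ _ glue_rel) chi_pt).
End Step.

Definition stage0 : stage 0 :=
  existT (fun T => ptmap _ T) (A 0)
    (hs_pr _ (@PtMap (A 0) (A 0) idfun (fun x => @cvg_id _ _) erefl)).

Fixpoint stages n : stage n :=
  match n with 0 => stage0 | n.+1 => step (stages n) end.

Definition realization n : ptopologicalType := projT1 (stages n).
Definition chi n : ptmap (hsmash (A n) (simplex R n)) (realization n) :=
  projT2 (stages n).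

Definition realization_incl n : ptmap (realization n) (realization n.+1) :=
  att1_ptmap (glue_rel (S := stages n)).
End FacialSpace.

Section Canonical.
Variables (X : ptopologicalType) (A : facial_resolution X).

(** [(d_0)^(n+1)] *)
Fixpoint aug_iter n : ptmap (A n) X :=
  match n with
  | 0 => fr_aug A
  | n.+1 => ptcomp (aug_iter n) (fs_d A (inord 0))
  end.

Lemma aug_iter_d n (i : 'I_n.+2) (x : A n.+1) :
  aug_iter n (fs_d A i x) = aug_iter n.+1 x.
Proof.
elim: n i x => [|n IHn] i x /=.
  rewrite -[i]inord_val; case: i => -[|[|//]] /= _ //.
  by rewrite fr_augd.
rewrite -[i]inord_val; case: i => -[|i] /= hi; first by [].
by rewrite (@fs_dd A n 0 i.+1) //= IHn.
Qed.

(** The requirement on the composite with [chi_n]; [realization_map_incl] states that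
    the canonical maps extend each other. *)
Definition is_canonical n (S : stage A n) (f : ptmap (projT1 S) X) :=
  forall x t, f (projT2 S (hs (x, t))) = aug_iter n x.

Section CanonicalStep.
Variables (n : nat) (S : stage A n) (f : ptmap (projT1 S) X).
Hypothesis fP : is_canonical f.

Lemma canonical_compat x y :
  glue_rel x y -> f x = hs_pr (simplex R n.+1) (aug_iter n.+1) y.
Proof. by move=> [i [a [t [-> ->]]]]; rewrite fP hs_prE aug_iter_d. Qed.

Definition canonical_step : ptmap (projT1 (step S)) X :=
  att_lift (pfun_cts (hs_pr (simplex R n.+1) (aug_iter n.+1))) canonical_compat.

Lemma canonical_stepP : @is_canonical n.+1 (step S) canonical_step.
Proof. by move=> x t; rewrite att_lift2 hs_prE. Qed.
End CanonicalStep.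

Lemma canonical0 : @is_canonical 0 (stage0 A) (fr_aug A).
Proof. by move=> x t; rewrite hs_prE. Qed.

Fixpoint canonical_sig n : {f | @is_canonical n (stages A n) f} :=
  match n with
  | 0 => exist _ _ canonical0
  | n.+1 => exist _ _ (canonical_stepP (svalP (canonical_sig n)))
  end.

(** The canonical map from [||A||_n] to [X]. *)
Definition realization_map n : ptmap (realization A n) X := sval (canonical_sig n).

Lemma realization_map_chi n x t : realization_map n (chi A n (hs (x, t))) = aug_iter n x.
Proof. exact: (svalP (canonical_sig n)). Qed.

Lemma realization_map_incl n x : realization_map n.+1 (realization_incl A n x) = realization_map n x.
Proof. exact: att_lift1. Qed.
End Canonical.

Section Lambda.
Variable X : ptopologicalType.

Fixpoint SOn n : ptopologicalType := if n is n.+1 then SO R (SOn n) else X.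

(** [SO^i (ev_(SO^(n-i) X)) : SO^(n+1) X -> SO^n X] for [i <= n], by recursion
    since [SO^(n+1) X] and [SO^i (SO^(n-i+1) X)] are not convertible; the value for
    [i > n] is irrelevant. *)
Fixpoint SOface n i {struct n} : ptmap (SOn n.+1) (SOn n) :=
  match n return ptmap (SOn n.+1) (SOn n) with
  | 0 => ev R X
  | m.+1 => if i is j.+1 then SO_map R (SOface m j) else ev R (SOn m.+1)
  end.

Lemma SOface0 n : SOface n 0 = ev R (SOn n).
Proof. by case: n. Qed.

Lemma SOface_face n i j : (i < j <= n.+1)%N -> forall x : SOn n.+2,
  SOface n i (SOface n.+1 j x) = SOface n j.-1 (SOface n.+1 i x).
Proof.
move=> /andP[]; elim: n i j => [|n IHn] i [|j]; rewrite ?ltn0 // ltnS => ij jn x.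
  move: jn ij; rewrite ltnS leqn0 => /eqP ->; rewrite leqn0 => /eqP ->.
  exact: ev_natural.
case: i ij => [|i] ij; first exact: ev_natural.
case: j ij jn => // j ij jn.
transitivity (SO_map R (ptcomp (SOface n i) (SOface n.+1 j.+1)) x).
  by rewrite SO_map_comp.
transitivity (SO_map R (ptcomp (SOface n j) (SOface n.+1 i)) x).
  by apply: SO_map_eq => y; exact: (IHn i j.+1 ij jn).
by rewrite SO_map_comp.
Qed.

Lemma Lambda_dd n i j : (i < j <= n.+2)%N -> forall x : SOn n.+3,
  SOface n.+1 (inord i : 'I_n.+2) (SOface n.+2 (inord j : 'I_n.+3) x) =
  SOface n.+1 (inord j.-1 : 'I_n.+2) (SOface n.+2 (inord i : 'I_n.+3) x).
Proof.
move=> ij x; have /andP[i_lt_j j_le] := ij.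
have i_lt : (i < n.+2)%N := leq_trans i_lt_j j_le.
have j_lt : (j.-1 < n.+2)%N by rewrite prednK // (leq_ltn_trans _ i_lt_j).
have -> : (inord i : 'I_n.+2) = i :> nat := inordK i_lt.
have -> : (inord i : 'I_n.+3) = i :> nat := inordK (leqW i_lt).
have -> : (inord j : 'I_n.+3) = j :> nat := inordK j_le.
have -> : (inord j.-1 : 'I_n.+2) = j.-1 :> nat := inordK j_lt.
exact: (@SOface_face n.+1 i j ij x).
Qed.

Definition Lambda_space : facial_space :=
  FacialSpace (fs_space := fun n => SOn n.+1)
    (fs_d := fun n i => SOface n.+1 i) Lambda_dd.

Lemma Lambda_augd (x : SOn 2) :
  ev R X (SOface 1 (inord 0 : 'I_2) x) = ev R X (SOface 1 (inord 1 : 'I_2) x).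
Proof. by rewrite !inordK // (@SOface_face 0 0 1). Qed.

Definition Lambda : facial_resolution X :=
  @FacialResolution X Lambda_space (ev R X) Lambda_augd.
End Lambda.

End Realization.

(* Main.v *)
Require Import Defs.
From mathcomp Require Import all_boot all_order all_algebra.
From mathcomp Require Import all_classical reals topology normedtype.
From mathcomp Require Import continuous_path.
From mathcomp Require Import ring lra.

Set Implicit Arguments.
Unset Strict Implicit.
Unset Printing Implicit Defensive.

Import Order.TTheory GRing.Theory Num.Theory.
Import numFieldNormedType.Exports.

Local Open Scope classical_set_scope.
Local Open Scope ring_scope.

(** Write Y for the space SO X, e for the evaluation map from Y to X, and M for
    the first stage of the realization. A point of the fibre F of the first Ganea
    map is a point y of Y with a path in X from e(y) to the base point. The points
    of M that do not come from Y lie on cells: for a loop w in Y and a time s, a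
    cell joins [[e w, s]], its end for t = 0, to w(s), its end for t = 1.

    From M to the second Ganea space. The loops w and s |-> [[e w, s]] in Y lie
    over the same loop in X. Running back along this loop in X joins each of its
    points to the base point, so that both loops lift to paths in F, and these two
    paths in F have the same end points. The two halves of a cell are mapped by
    climbing the cone over F from the one path and from the other. They meet at
    the vertex of the cone for s <= 1/2, and in the common end point of the paths
    for s >= 1/2. See [ganea_cell] and [first_stage_to_ganea].

    From the second Ganea space to M. This space deforms to the mapping cone of
    the inclusion of F in the first Ganea space, which in turn projects to Y. What
    is needed is a null-homotopy in M of the projection from F to Y. Over the point
    y = [[a, s]] with a path c from e(y) to the base point it starts as follows:
    go back along [[a, _]] to the base point, then run through the class in Y of
    the loop that follows a up to time s and then c (see [lasso]). For s = 0 this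
    depends on c only. For s = 1 it is a loop in Y, and the cell of M attached to
    it leads to the class of a loop in X that runs back along a, forth along a,
    and then along c. Cancelling the detour along a gives again something that
    depends on c only (see [reel]).

    But in the reduced suspension Y the points [[a, 0]] and [[a, 1]] agree, and
    they agree with [[a, s]] for constant a, whereas the two paths just obtained
    differ by a cell, which is not degenerate even for constant a. So this cell is
    traversed backwards in a last step, with a replaced by the constant loop. For
    constant a the whole then goes forth and back along one cell and can be
    contracted by cutting it short. To make room for this, one uses that X is
    well-pointed: there is a deformation of X that moves a neighbourhood of the
    base point to the base point, hence one of the loop space that makes all loops
    near the constant one constant ([well_pointed_contraction], [loop_sup]). See [contraction] and
    [ganea_to_first_stage].

    Continuity is tested on maps from compact Hausdorff spaces, and homotopies are
    handled as maps to path spaces. The one delicate point is continuity on F,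
    which is a subspace of a product with the quotient Y. It can be tested before
    passing to the quotient because X is weak Hausdorff
    ([fiber_continuous_test]). *)

Local Notation fpath := Defs.fpath.

(** * Compact Hausdorff test spaces *)

Definition compact_hausdorff (K : topologicalType) : Prop :=
  compact [set: K] /\ hausdorff_space K.

Lemma continuous_compose (S T U : topologicalType) (f : S -> T) (g : T -> U) :
  continuous f -> continuous g -> continuous (fun x => g (f x)).
Proof. by move=> cf cg x; apply: continuous_comp; [exact: cf|exact: cg]. Qed.

Lemma continuous_fst (S T U : topologicalType) (f : S -> T * U) :
  continuous f -> continuous (fun x => (f x).1).
Proof. by move=> cf; apply: (continuous_compose cf) => x; exact: cvg_fst. Qed.

Lemma continuous_snd (S T U : topologicalType) (f : S -> T * U) :
  continuous f -> continuous (fun x => (f x).2).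
Proof. by move=> cf; apply: (continuous_compose cf) => x; exact: cvg_snd. Qed.

Lemma continuous_id (S : topologicalType) : continuous (fun x : S => x).
Proof. by move=> x; exact: cvg_id. Qed.

Lemma continuous_cst (S T : topologicalType) (a : T) : continuous (fun _ : S => a).
Proof. by move=> x; exact: cvg_cst. Qed.

Lemma set_val_continuous (T : topologicalType) (A : set T) :
  continuous (val : set_type A -> T).
Proof. exact: (@initial_continuous _ _ (set_val : A -> T)). Qed.

Lemma continuous_to_set_type (S T : topologicalType) (A : set T)
    (f : S -> set_type A) :
  continuous (fun x => val (f x)) -> continuous f.
Proof.
move=> cf; exact: (@continuous_comp_initial _ S T (set_val : A -> T) f).
Qed.

Lemma closed_set_val_image (T : topologicalType) (A : set T)
    (C : set (set_type A)) :
  closed A -> closed C -> closed (val @` C).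
Proof.
move=> cA /closed_openC [O oO OC].
have -> : val @` C = A `&` ~` O.
  apply/seteqP; split => [_ [x Cx <-]|x [Ax nOx]] /=.
    split; first exact: set_mem (valP x).
    move=> Ox; have : (~` C) x by rewrite -OC.
    by apply.
  exists (exist _ x (mem_set Ax)) => //; apply: contrapT => nC.
  by apply: nOx; have : (~` C) (exist _ x (mem_set Ax)) by []; rewrite -OC.
by apply: closedI => //; exact: open_closedC.
Qed.

Lemma compact_hausdorff_set_type (K : topologicalType) (A : set K) :
  compact_hausdorff K -> closed A -> compact_hausdorff (set_type A).
Proof.
move=> [cK hK] cA; split.
  move=> F FF _.
  have FA : ((val : set_type A -> K) @ F) A.
    by apply: (@filterS _ F _ setT) => [x _|]; [exact: set_mem (valP x)|exact: filterT].
  have [p [pA clp]] := subclosed_compact cA cK (@subsetT _ _) _ FA.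
  exists (exist _ p (mem_set pA)); split=> //.
  move=> B C FB [_ [[W oW <-] /= Wp WC]].
  have [|_ [[x Bx <-] Wx]] := clp (val @` B) W _ (open_nbhs_nbhs (conj oW Wp)).
    by apply: (@filterS _ F _ B) => // x Bx; exists x.
  by exists x; split=> //; exact: WC.
move=> p q pq; apply/val_inj/hK => C D nC nD.
have nC' : nbhs p (val @^-1` C) by apply: set_val_continuous; exact: nC.
have nD' : nbhs q (val @^-1` D) by apply: set_val_continuous; exact: nD.
by have [x [? ?]] := pq _ _ nC' nD'; exists (val x).
Qed.

Lemma compact_hausdorff_prod (K L : topologicalType) :
  compact_hausdorff K -> compact_hausdorff L -> compact_hausdorff (K * L)%type.
Proof.
move=> [cK hK] [cL hL]; split.
  by rewrite -setXTT; exact: compact_setX.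
move=> p q pq; apply/eqP; rewrite -pair_eqE; apply/andP; split; apply/eqP.
  apply: hK => A B nA nB.
  have [x [Ax Bx]] := pq _ _ (@cvg_fst _ _ (nbhs p.1) (nbhs p.2) _ _ nA)
    (@cvg_fst _ _ (nbhs q.1) (nbhs q.2) _ _ nB).
  by exists x.1.
apply: hL => A B nA nB.
have [x [Ax Bx]] := pq _ _ (@cvg_snd _ _ (nbhs p.1) (nbhs p.2) _ _ nA)
  (@cvg_snd _ _ (nbhs q.1) (nbhs q.2) _ _ nB).
by exists x.2.
Qed.

Lemma compact_hausdorff_I01 (R : realType) : compact_hausdorff (I01 R).
Proof. by split; [exact: I01_compact|exact: I01_hausdorff]. Qed.

(** The tube lemma. *)
Lemma open_tube (T K : topologicalType) (W : set (T * K)) (N : set K) :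
  compact N -> open W -> open [set a | forall k, N k -> W (a, k)].
Proof.
move=> /compact_near_coveringP cN oW; rewrite openE => a Wa.
rewrite /interior; apply: (cN T (nbhs a) (fun a k => W (a, k))) => k Nk.
have : nbhs (a, k) W by apply: open_nbhs_nbhs; split=> //; exact: Wa.
case=> -[P Q] /= [nP nQ] PQ; exists (Q, P) => //= -[k' a'] /= [Qk Pa].
exact: (PQ (a', k')).
Qed.

Lemma compact_hausdorff_nbhs (K : topologicalType) (N : set K) (k : K) :
  compact_hausdorff K -> open N -> N k ->
  exists C D : set K, [/\ compact C, open D, D k, D `<=` C & C `<=` N].
Proof.
move=> [cK hK] oN Nk.
have [] := @compact_regular K k setT hK cK filterT N.
  exact: open_nbhs_nbhs.
move=> D; rewrite nbhsE => -[D' [oD' D'k] DD'] DN.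
exists (closure D), D'; split=> //.
  exact: (subclosed_compact (@closed_closure _ _) cK (@subsetT _ _)).
by move=> x /DD'; exact: subset_closure.
Qed.

Definition is_quotient (A B : topologicalType) (p : A -> B) : Prop :=
  (forall b, exists a, p a = b) /\ forall U, open (p @^-1` U) -> open U.

Lemma is_quotient_qpi (T : ptopologicalType) (r : T -> T -> Prop) :
  is_quotient (@qpi T r).
Proof.
split=> [|U oU]; last exact: oU.
by apply: quot_ind => x; exists x.
Qed.

(** Whitehead's lemma. Around a point of the open preimage there is a product
    with a compact neighbourhood [C] in [K]; the points [b] with [b] times [C]
    inside [U] form an open set, because by the tube lemma they do so upstairs. *)
Lemma is_quotient_prod (A B K : topologicalType) (p : A -> B) :
  compact_hausdorff K -> is_quotient p ->
  is_quotient (fun x : A * K => (p x.1, x.2)).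
Proof.
move=> chK [ps pq]; split=> [[b k]|U oU].
  by have [a <-] := ps b; exists (a, k).
rewrite openE => -[b0 k0] Ubk; rewrite /interior.
have [a0 ab0] := ps b0; rewrite -ab0 in Ubk *.
pose N := [set k | U (p a0, k)].
have oN : open N.
  have /continuousP/(_ _ oU) : continuous (fun k : K => (a0, k)).
    by apply: pair_continuous; [exact: continuous_cst|exact: continuous_id].
  by [].
have [C [D [cC oD Dk DC CN]]] := compact_hausdorff_nbhs chK oN Ubk.
pose V := [set b | forall k, C k -> U (b, k)].
have oV : open V.
  by apply: pq; exact: (@open_tube A K _ C cC oU).
exists (V, D); last by move=> [b k] /= [Vb Dk']; exact/Vb/DC.
by split; apply: open_nbhs_nbhs; split.
Qed.

(** The argument of Whitehead's lemma, with the tube lemma applied over each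
    compact Hausdorff space mapped to [T] instead of over a covering space. *)
Lemma compactly_generated_prod (T K : topologicalType) :
  compact_hausdorff K -> compactly_generated T -> compactly_generated (T * K)%type.
Proof.
move=> chK cgT U kU; rewrite openE => -[a0 k0] Uak; rewrite /interior.
pose N := [set k | U (a0, k)].
have oN : open N.
  apply: (kU K (fun k => (a0, k))); [exact: chK.1|exact: chK.2|].
  by apply: pair_continuous; [exact: continuous_cst|exact: continuous_id].
have [C [D [cC oD Dk DC CN]]] := compact_hausdorff_nbhs chK oN Uak.
pose V := [set b | forall k, C k -> U (b, k)].
have oV : open V.
  apply: cgT => L f cL hL cf.
  apply: (@open_tube L K (fun q => U (f q.1, q.2)) C cC).
  have [cLK hLK] := compact_hausdorff_prod (conj cL hL) chK.
  apply: (kU (L * K)%type (fun q => (f q.1, q.2))) => //.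
  apply: pair_continuous; last by apply: continuous_snd; exact: continuous_id.
  by apply: continuous_compose cf; apply: continuous_fst; exact: continuous_id.
exists (V, D); last by move=> [b k] /= [Vb Dk']; exact/Vb/DC.
by split; apply: open_nbhs_nbhs; split.
Qed.

Lemma compactly_generated_kify (T : topologicalType) :
  compactly_generated (kify T).
Proof.
move=> U kU; rewrite kify_openE => K f cK hK cf; apply: (kU K f) => //.
by apply/continuousP => V; rewrite kify_openE; apply.
Qed.

Lemma compactly_generated_continuous (S T : topologicalType) (f : S -> T) :
  compactly_generated S ->
  (forall (K : topologicalType) (c : K -> S),
     compact_hausdorff K -> continuous c -> continuous (fun k => f (c k))) ->
  continuous f.
Proof.
move=> cgS tf; apply/continuousP => U oU; apply: cgS => K c cK hK cc.
have /continuousP/(_ _ oU) := tf K c (conj cK hK) cc.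
by [].
Qed.

Lemma continuous_to_kify (K T : topologicalType) (f : K -> T) :
  compact_hausdorff K -> continuous f -> continuous (f : K -> kify T).
Proof.
by move=> [cK hK] cf; apply/continuousP => U; rewrite kify_openE; apply.
Qed.

(** * Pasting along closed covers *)

Lemma continuous_paste (T Z : topologicalType) (A B : set T) (f : T -> Z) :
  closed A -> closed B -> (forall x, A x \/ B x) ->
  continuous (fun x : set_type A => f (val x)) ->
  continuous (fun x : set_type B => f (val x)) -> continuous f.
Proof.
move=> cA cB AB /continuous_closedP fA /continuous_closedP fB.
apply/continuous_closedP => C cC.
have -> : f @^-1` C =
    (val @` ((fun x : set_type A => f (val x)) @^-1` C)) `|`
    (val @` ((fun x : set_type B => f (val x)) @^-1` C)).
  apply/seteqP; split => [x Cx|x [[a Ca <-]|[b Cb <-]]] //.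
  have [Ax|Bx] := AB x.
    by left; exists (exist _ x (mem_set Ax)).
  by right; exists (exist _ x (mem_set Bx)).
by apply: closedU; apply: closed_set_val_image => //; [exact: fA|exact: fB].
Qed.

Section RealFunctions.
Context {R : realType}.

Lemma closed_le_fun (T : topologicalType) (c d : T -> R) :
  continuous c -> continuous d -> closed [set x | c x <= d x].
Proof.
move=> cc cd.
have -> : [set x | c x <= d x] = (fun x => d x - c x) @^-1` [set y | 0 <= y].
  by apply/seteqP; split=> x /=; rewrite subr_ge0.
apply: closed_comp; last exact: closed_ge.
by move=> x _; apply: continuousB; [exact: cd|exact: cc].
Qed.

(** Each of the two formulas is required to be continuous only where it is used,
    since elsewhere it may fail to make sense: a path that should be a loop there
    may not close up. *)
Lemma if_le_continuous (T Z : topologicalType) (c d : T -> R) (f g : T -> Z) :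
  continuous c -> continuous d ->
  continuous (fun x : set_type [set x | c x <= d x] => f (val x)) ->
  continuous (fun x : set_type [set x | d x <= c x] => g (val x)) ->
  (forall x, c x = d x -> f x = g x) ->
  continuous (fun x => if c x <= d x then f x else g x).
Proof.
move=> cc cd cf cg fg.
apply: (@continuous_paste _ _ [set x | c x <= d x] [set x | d x <= c x]).
- exact: closed_le_fun.
- exact: closed_le_fun.
- by move=> x; apply/orP; exact: le_total.
- have -> // : (fun x : set_type [set x | c x <= d x] =>
    if c (val x) <= d (val x) then f (val x) else g (val x)) = (fun x => f (val x)).
  by apply/funext => x; rewrite (set_mem (valP x)).
- have -> // : (fun x : set_type [set x | d x <= c x] =>
    if c (val x) <= d (val x) then f (val x) else g (val x)) = (fun x => g (val x)).
  apply/funext => x; have /= dc := set_mem (valP x).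
  by case: ifP => // cd'; apply: fg; apply/le_anti/andP.
Qed.

Section Arithmetic.
Variables (T : topologicalType) (f g : T -> R).
Hypotheses (cf : continuous f) (cg : continuous g).

Lemma continuous_addr : continuous (fun x => f x + g x).
Proof. by move=> x; apply: continuousD; [exact: cf|exact: cg]. Qed.

Lemma continuous_oppr : continuous (fun x => - f x).
Proof. by move=> x; apply: continuousN; exact: cf. Qed.

Lemma continuous_mulr : continuous (fun x => f x * g x).
Proof. by move=> x; apply: continuousM; [exact: cf|exact: cg]. Qed.

Lemma continuous_maxr : continuous (fun x => Num.max (f x) (g x)).
Proof. by move=> x; apply: continuous_max; [exact: cf|exact: cg]. Qed.

Lemma continuous_minr : continuous (fun x => Num.min (f x) (g x)).
Proof. by move=> x; apply: continuous_min; [exact: cf|exact: cg]. Qed.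
End Arithmetic.

(** The retraction of the line onto the unit interval *)
Lemma clamp_subproof (x : R) : Num.max 0 (Num.min 1 x) \in (`[0, 1]%classic : set R).
Proof.
by rewrite inE /= in_itv /= le_max lexx /= ge_max ler01 ge_min lexx.
Qed.
Definition clamp (x : R) : I01 R :=
  exist (fun y => y \in (`[0, 1]%classic : set R)) _ (clamp_subproof x).

Lemma clamp_continuous : continuous clamp.
Proof.
apply: continuous_to_set_type => /=.
apply: continuous_maxr; first exact: continuous_cst.
by apply: continuous_minr; [exact: continuous_cst|exact: continuous_id].
Qed.

Lemma I01_ge0 (t : I01 R) : 0 <= val t.
Proof. by case: t => t /= /set_mem /=; rewrite in_itv /= => /andP[]. Qed.

Lemma I01_le1 (t : I01 R) : val t <= 1.
Proof. by case: t => t /= /set_mem /=; rewrite in_itv /= => /andP[]. Qed.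

Lemma val_clamp (x : R) : 0 <= x -> x <= 1 -> val (clamp x) = x.
Proof. by move=> x0 x1 /=; rewrite (min_idPr x1) (max_idPr x0). Qed.

Lemma clamp_val (t : I01 R) : clamp (val t) = t.
Proof. by apply/val_inj/val_clamp; [exact: I01_ge0|exact: I01_le1]. Qed.

Lemma clamp_le0 (x : R) : x <= 0 -> clamp x = zero.
Proof.
move=> x0; apply/val_inj => /=; rewrite (min_idPr _) ?(le_trans x0 ler01) //.
exact/max_idPl.
Qed.

Lemma clamp_ge1 (x : R) : 1 <= x -> clamp x = one.
Proof.
by move=> x1; apply/val_inj => /=; rewrite (min_idPl x1); exact/max_idPr/ler01.
Qed.

Lemma val_zero : val (zero : I01 R) = 0 :> R. Proof. by []. Qed.
Lemma val_one : val (one : I01 R) = 1 :> R. Proof. by []. Qed.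

Lemma clamp0 : clamp 0 = zero. Proof. exact: clamp_le0. Qed.
Lemma clamp1 : clamp 1 = one. Proof. exact: clamp_ge1. Qed.

End RealFunctions.

Lemma continuous_clamp (R : realType) (T : topologicalType) (f : T -> R) :
  continuous f -> continuous (fun x => clamp (f x)).
Proof. by move=> cf; apply: (continuous_compose cf); exact: clamp_continuous. Qed.

Lemma continuous_val (R : realType) (T : topologicalType) (f : T -> I01 R) :
  continuous f -> continuous (fun x => val (f x) : R).
Proof. by move=> cf; apply: (continuous_compose cf); exact: I01_val_continuous. Qed.


(** * Families of paths and loops *)

Section Paths.
Context {R : realType}.
Notation I := (I01 R).

Definition path_at (X : ptopologicalType) (w : fpath R X) (t : I) : X :=
  (w : continuousType I X) t.

Definition loop_at (X : ptopologicalType) (w : Om R X) (t : I) : X :=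
  (w : {path I from (point : X) to (point : X) in X}) t.

(** Without the proof of continuity as an argument, so that formulas for paths can
    be written down before they are known to make sense. *)
Definition mk_fpath (X : ptopologicalType) (f : I -> X) : fpath R X :=
  if pselect (continuous f) is left cf then
    (mk_path cf erefl erefl : {path I from f zero to f one} )
      : continuousType I X
  else point.

Definition is_loop (X : ptopologicalType) (f : I -> X) : Prop :=
  [/\ continuous f, f zero = point & f one = point].

Definition mk_loop (X : ptopologicalType) (f : I -> X) : Om R X :=
  if pselect (is_loop f) is left (And3 cf f0 f1) then
    (mk_path cf f0 f1 : {path I from (point : X) to (point : X) in X})
  else point.

Lemma path_at_mk (X : ptopologicalType) (f : I -> X) t :
  continuous f -> path_at (mk_fpath f) t = f t.
Proof. by rewrite /mk_fpath; case: pselect. Qed.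

Lemma loop_at_mk (X : ptopologicalType) (f : I -> X) t :
  is_loop f -> loop_at (mk_loop f) t = f t.
Proof. by rewrite /mk_loop; case: pselect => // -[]. Qed.

Lemma fpath_eqP (X : ptopologicalType) (v w : fpath R X) :
  (forall t, path_at v t = path_at w t) -> v = w.
Proof.
rewrite /path_at; move: v w => [f [[cf]]] [g [[cg]]] /= fg.
move/funext: fg cf cg => -> cf cg.
by rewrite (Prop_irrelevance cf cg).
Qed.

Lemma loop_eqP (X : ptopologicalType) (v w : Om R X) :
  (forall t, loop_at v t = loop_at w t) -> v = w.
Proof. by move=> vw; apply/path_eqP. Qed.

Lemma loop_at0 (X : ptopologicalType) (w : Om R X) : loop_at w zero = point.
Proof. exact: path_zero. Qed.

Lemma loop_at1 (X : ptopologicalType) (w : Om R X) : loop_at w one = point.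
Proof. exact: path_one. Qed.

Lemma ev_sg (X : ptopologicalType) (w : Om R X) (t : I) :
  ev R X (sg (w, t)) = loop_at w t.
Proof. exact: evE. Qed.

Lemma path_at_continuous (T : topologicalType) (X : ptopologicalType)
    (c : T -> fpath R X) (s : T -> I) :
  continuous c -> continuous s -> continuous (fun k => path_at (c k) (s k)).
Proof.
move=> cc cs.
have cc' : continuous (fun k => (c k : continuousType I X) : {compact-open, I -> X}).
  exact: (continuous_compose cc (@initial_continuous _ _
    (fun w : fpath R X => (w : continuousType I X) : {compact-open, I -> X}))).
have := path_eval_continuous cc' (fun k => @cts_fun _ _ (c k : continuousType I X)).
by move=> ce; apply: (continuous_compose (pair_continuous (@continuous_id T) cs) ce).
Qed.

Lemma loop_at_continuous (T : topologicalType) (X : ptopologicalType)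
    (c : T -> Om R X) (s : T -> I) :
  continuous c -> continuous s -> continuous (fun k => loop_at (c k) (s k)).
Proof.
move=> cc cs.
exact: (continuous_compose (pair_continuous cc cs) (@ev_fun_continuous R X)).
Qed.

Lemma curry_continuous (T : topologicalType) (X : ptopologicalType)
    (F : T -> I -> X) :
  continuous (fun p : T * I => F p.1 p.2) ->
  continuous (F : T -> {compact-open, I -> X}) /\ forall t, continuous (F t).
Proof.
move=> cF; have [cF1 cF2] := continuous_curry cF; split; last exact: cF2.
exact: cF1.
Qed.

Lemma mk_fpath_continuous (T : topologicalType) (X : ptopologicalType)
    (F : T -> I -> X) :
  continuous (fun p : T * I => F p.1 p.2) -> continuous (fun t => mk_fpath (F t)).
Proof.
move=> /curry_continuous[cF1 cF2].
apply: (@continuous_comp_initial (fpath R X) T {compact-open, I -> X}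
  (fun w : fpath R X => (w : continuousType I X) : {compact-open, I -> X})).
have -> // : (fun w : fpath R X => (w : continuousType I X) : {compact-open, I -> X})
  \o (fun t => mk_fpath (F t)) = (F : T -> {compact-open, I -> X}).
by apply/funext => t; apply/funext => u /=; exact: path_at_mk.
Qed.

(** [K] has to be compact Hausdorff because the loop space carries the compactly
    generated refinement of the compact-open topology. *)
Lemma mk_loop_continuous (K : topologicalType) (X : ptopologicalType)
    (F : K -> I -> X) :
  compact_hausdorff K ->
  continuous (fun p : K * I => F p.1 p.2) ->
  (forall k, F k zero = point) -> (forall k, F k one = point) ->
  (forall k, is_loop (F k)) /\ continuous (fun k => mk_loop (F k)).
Proof.
move=> chK /curry_continuous[cF1 cF2] F0 F1.
have loopF k : is_loop (F k) by split; [exact: cF2|exact: F0|exact: F1].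
split=> //; apply: continuous_to_kify => //.
apply: (@continuous_comp_initial
  {path I from (point : X) to (point : X) in X} K {compact-open, I -> X}
  (fun w : {path I from (point : X) to (point : X) in X} =>
    w : {compact-open, I -> X})).
have -> // : (fun w : {path I from (point : X) to (point : X) in X} =>
    w : {compact-open, I -> X})
  \o (fun k => mk_loop (F k)) = (F : K -> {compact-open, I -> X}).
by apply/funext => t; apply/funext => u; exact: loop_at_mk.
Qed.

(** Homotopies out of quotients and mapping cones are constructed in this form, by
    the same universal properties as maps. *)
Lemma phomotopic_of_paths (X Y : ptopologicalType) (f g : ptmap X Y)
    (H : ptmap X (fpath R Y)) :
  (forall x, path_at (H x) zero = f x) -> (forall x, path_at (H x) one = g x) ->
  phomotopic R f g.
Proof.
move=> H0 H1; exists (fun p => path_at (H p.1) p.2); split=> //.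
  apply: path_at_continuous.
    by refine (continuous_compose _ (pfun_cts H)); apply: continuous_fst;
      exact: continuous_id.
  by apply: continuous_snd; exact: continuous_id.
by move=> t; rewrite /= pfun_pt.
Qed.

Lemma phomotopic_precomp (W X Y : ptopologicalType) (f g : ptmap X Y)
    (h : ptmap W X) :
  phomotopic R f g -> phomotopic R (ptcomp f h) (ptcomp g h).
Proof.
move=> [H [cH H0 H1 Hp]]; exists (fun p => H (h p.1, p.2)); split=> //.
- refine (continuous_compose _ cH); apply: pair_continuous.
    by refine (continuous_compose _ (pfun_cts h)); apply: continuous_fst;
      exact: continuous_id.
  by apply: continuous_snd; exact: continuous_id.
- by move=> t /=; rewrite pfun_pt.
Qed.

Lemma phomotopic_trans (X Y : ptopologicalType) (f g h : ptmap X Y) :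
  phomotopic R f g -> phomotopic R g h -> phomotopic R f h.
Proof.
move=> [H [cH H0 H1 Hp]] [G [cG G0 G1 Gp]].
pose t (p : X * I) : R := val p.2.
have ct : continuous t.
  by apply: continuous_val; apply: continuous_snd; exact: continuous_id.
have cx (A : set (X * I)) : continuous (fun p : set_type A => (val p).1).
  by apply: continuous_fst; exact: set_val_continuous.
have ctA (A : set (X * I)) : continuous (fun p : set_type A => t (val p)).
  by refine (continuous_compose _ ct); exact: set_val_continuous.
exists (fun p => if t p <= 1 / 2 then H (p.1, clamp (2 * t p))
                 else G (p.1, clamp (2 * t p - 1))); split.
- apply: (@if_le_continuous R _ _ _ _
    (fun p => H (p.1, clamp (2 * t p))) (fun p => G (p.1, clamp (2 * t p - 1)))) => //.
  + exact: continuous_cst.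
  + refine (continuous_compose _ cH); apply: pair_continuous; first exact: cx.
    apply: continuous_clamp; apply: continuous_mulr; last exact: ctA.
    exact: continuous_cst.
  + refine (continuous_compose _ cG); apply: pair_continuous; first exact: cx.
    apply: continuous_clamp; apply: continuous_addr; last exact: continuous_cst.
    by apply: continuous_mulr; [exact: continuous_cst|exact: ctA].
  + move=> p ->; have -> : 2 * (1 / 2) - 1 = 0 :> R by field.
    have -> : 2 * (1 / 2) = 1 :> R by field.
    by rewrite clamp0 clamp1 H1 G0.
- by move=> x; rewrite /t /= ifT ?mulr0 ?clamp0 //; lra.
- move=> x; rewrite /t /= ifF; last by apply/negbTE; rewrite -ltNge; lra.
  have -> : 2 * 1 - 1 = 1 :> R by ring.
  by rewrite clamp1.
- by move=> s; case: ifP.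
Qed.

End Paths.

(** Reduces the continuity of an expression to that of its variables. *)
Ltac continuity_step :=
  match goal with
  | H : continuous ?f |- continuous ?f => exact: H
  | |- continuous (fun x => x) => exact: continuous_id
  | |- continuous (fun _ => ?a) => exact: continuous_cst
  | H : continuous ?f |- continuous (fun x => ?f x) => exact: H
  | |- continuous (@fst _ _) => by move=> ?; exact: cvg_fst
  | |- continuous (@snd _ _) => by move=> ?; exact: cvg_snd
  | |- continuous (fun x => (_, _)) => apply: pair_continuous
  | |- continuous (fun x => _ + _) => apply: continuous_addr
  | |- continuous (fun x => - _) => apply: continuous_oppr
  | |- continuous (fun x => _ * _) => apply: continuous_mulr
  | |- continuous (fun x => Num.max _ _) => apply: continuous_maxr
  | |- continuous (fun x => Num.min _ _) => apply: continuous_minr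
  | |- continuous (fun x => clamp _) => apply: continuous_clamp
  | |- continuous (fun x => path_at _ _) => apply: path_at_continuous
  | |- continuous (fun x => loop_at _ _) => apply: loop_at_continuous
  | |- continuous (fun x => fst _) => apply: continuous_fst
  | |- continuous (fun x => snd _) => apply: continuous_snd
  | |- continuous (fun x => pfun ?f _) =>
      refine (continuous_compose _ (pfun_cts f))
  | |- continuous (fun x => val _) =>
      first [apply: continuous_val | exact: set_val_continuous
            | refine (continuous_compose _ (@set_val_continuous _ _))]
  | H : continuous ?f |- continuous (fun x => ?f _) =>
      refine (continuous_compose _ H)
  | |- continuous _ => exact: set_val_continuous
  | |- continuous _ => exact: I01_val_continuous
  end.
Ltac continuity := repeat continuity_step.


(** * The first stage of the realization *)

Section FirstStage.
Context {R : realType}.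
Notation I := (I01 R).

Lemma edge_subproof (t : I) :
  simplex_set (\row_(j < 2) (if j == ord0 then 1 - val t else val t) : 'rV[R]_2).
Proof.
split=> [j|]; last by rewrite big_ord_recl big_ord1 !mxE /= subrK.
by rewrite mxE; case: ifP => _; rewrite ?subr_ge0 ?I01_le1 ?I01_ge0.
Qed.

Definition edge (t : I) : simplex R 1 :=
  exist (fun t => t \in @simplex_set R 1) _ (mem_set (edge_subproof t)).

Definition edge_coord (t : simplex R 1) : I := clamp ((val t : 'rV_2) ord0 ord_max).

Lemma edge_coordK t : edge_coord (edge t) = t.
Proof. by rewrite /edge_coord mxE /= clamp_val. Qed.

Lemma edge_coord_continuous : continuous edge_coord.
Proof.
apply: continuous_clamp.
exact: (continuous_compose (@set_val_continuous _ _) (@coord_continuous _ _ _ _ _)).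
Qed.

Lemma edge_continuous : continuous edge.
Proof.
apply: continuous_to_set_type => t A [P nP PA].
have entry i j : continuous (fun t : I => (val (edge t) : 'rV[R]_2) i j).
  have cv : continuous (val : I -> R) := I01_val_continuous.
  have -> : (fun t : I => (val (edge t) : 'rV[R]_2) i j) =
      (fun t : I => if j == ord0 then 1 - val t else val t).
    by apply/funext => s; rewrite mxE.
  by case: (j == ord0); continuity.
pose Q i j := [set t' : I | P i j ((val (edge t') : 'rV[R]_2) i j)].
have nQ : nbhs t [set t' | forall i j, Q i j t'].
  apply: (@filter_forall I _ (fun i t' => forall j, Q i j t') _ (nbhs_filter t)) => i.
  apply: (@filter_forall I _ (Q i) _ (nbhs_filter t)) => j.
  exact/entry/nP.
by apply: (@filterS _ _ (nbhs_filter t) _ _ _ nQ) => t' Pt'; exact: PA.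
Qed.

Lemma simplex1_eq (s t : simplex R 1) :
  (val s : 'rV_2) ord0 ord_max = (val t : 'rV_2) ord0 ord_max -> s = t.
Proof.
move=> st; apply/val_inj/rowP => j.
have [_] := set_mem (valP s); have [_] := set_mem (valP t).
rewrite !big_ord_recl !big_ord0 !addr0 /=.
have -> : lift ord0 ord0 = ord_max :> 'I_2 by exact/val_inj.
rewrite -st => t1 s1.
have st0 : (val s : 'rV_2) ord0 ord0 = (val t : 'rV_2) ord0 ord0.
  by apply: (addIr ((val s : 'rV_2) ord0 ord_max)); rewrite s1 t1.
case: j => -[|[|//]] j2.
  by have -> : Ordinal j2 = ord0 by exact/val_inj.
by have -> : Ordinal j2 = ord_max by exact/val_inj.
Qed.

Lemma coface_edge0 (t : simplex R 0) : coface (ord_max : 'I_2) t = edge zero.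
Proof.
apply: simplex1_eq; rewrite !mxE /=.
by rewrite (_ : unlift _ _ = None) //; exact: unlift_none.
Qed.

Lemma coface_edge1 (t : simplex R 0) : coface (ord0 : 'I_2) t = edge one.
Proof.
apply: simplex1_eq; rewrite !mxE /=.
have -> : ord_max = lift ord0 ord0 :> 'I_2 by exact/val_inj.
rewrite liftK.
by have [_] := set_mem (valP t); rewrite big_ord1.
Qed.

Lemma realization_glue (A : facial_space) n (i : 'I_n.+2) (a : A n.+1)
    (t : simplex R n) :
  chi R A n.+1 (hs (a, coface i t)) =
  realization_incl R A n (chi R A n (hs (fs_d A i a, t))).
Proof. by symmetry; apply: att_glue; exists i, a, t. Qed.

Lemma chi_vertex (A : facial_space) (a : A 0%N) (t : simplex R 0) :
  chi R A 0 (hs (a, t)) = a.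
Proof. exact: hs_prE. Qed.

Variable X : ptopologicalType.
Notation Y := (SO R X).
Notation M := (realization R (Lambda R X) 1).

Definition vertex_incl : ptmap Y M := realization_incl R (Lambda R X) 0.

Definition cell (w : Om R Y) (s t : I) : M :=
  chi R (Lambda R X) 1 (hs (sg (w, s) : SO R Y, edge t)).

Lemma cell_zero w s : cell w s zero = vertex_incl (sg (Om_map R (ev R X) w, s)).
Proof.
rewrite /cell -(coface_edge0 (vertex R 0)).
rewrite (@realization_glue (Lambda R X) 0) chi_vertex.
congr (pfun vertex_incl _); exact: Sg_mapE.
Qed.

Lemma cell_one w s : cell w s one = vertex_incl (loop_at w s).
Proof.
rewrite /cell -(coface_edge1 (vertex R 0)).
rewrite (@realization_glue (Lambda R X) 0) chi_vertex.
congr (pfun vertex_incl _); exact: evE.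
Qed.

Lemma sg_pt (Z : ptopologicalType) (z : Z) (t : I) :
  z = point \/ t = zero \/ t = one -> sg (z, t) = point.
Proof. by move=> h; apply: qpi_eq; split=> //=; left. Qed.

Lemma cell_pt w s t : s = zero \/ s = one -> cell w s t = point.
Proof. by move=> h; rewrite /cell sg_pt ?hs_pt ?pfun_pt; last by right. Qed.

Lemma cell_continuous (T : topologicalType) (w : T -> Om R Y) (s t : T -> I) :
  continuous w -> continuous s -> continuous t ->
  continuous (fun k => cell (w k) (s k) (t k)).
Proof.
move=> cw cs ct; rewrite /cell.
refine (continuous_compose _ (pfun_cts _)).
refine (continuous_compose _ (@qpi_continuous _ _)).
apply: pair_continuous; last exact: (continuous_compose ct edge_continuous).
exact: (continuous_compose (pair_continuous cw cs) (@qpi_continuous _ _)).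
Qed.

Lemma realization_map_vertex (y : Y) :
  realization_map R (Lambda R X) 1 (vertex_incl y) = ev R X y.
Proof. by rewrite realization_map_incl. Qed.

Lemma realization_map_cell w s t :
  realization_map R (Lambda R X) 1 (cell w s t) = ev R X (loop_at w s).
Proof.
by rewrite /cell realization_map_chi /= inordK // [ev R _ _]evE.
Qed.

Lemma first_stage_ind (P : M -> Prop) :
  (forall y, P (vertex_incl y)) -> (forall w s t, P (cell w s t)) -> forall m, P m.
Proof.
move=> Py Pc; apply: quot_ind => -[[] x]; first exact: Py.
move: x; apply: hsmash_ind => z t; move: z; apply: Sg_ind => w s.
have -> : t = edge (edge_coord t).
  have [t0] := set_mem (valP t); rewrite !big_ord_recl big_ord0 addr0 => t1.
  apply: simplex1_eq; rewrite mxE /edge_coord val_clamp //.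
  have -> : ord_max = lift ord0 ord0 :> 'I_2 by exact/val_inj.
  by rewrite -t1 lerDr.
exact: (Pc w s (edge_coord t)).
Qed.

Section Rec.
Variables (Z : ptopologicalType) (f : ptmap Y Z) (g : Om R Y -> I -> I -> Z).
Hypothesis g_cts : forall (K : topologicalType) (w : K -> Om R Y) (s t : K -> I),
  compact_hausdorff K -> continuous w -> continuous s -> continuous t ->
  continuous (fun k => g (w k) (s k) (t k)).
Hypothesis g0 : forall w s, g w s zero = f (sg (Om_map R (ev R X) w, s)).
Hypothesis g1 : forall w s, g w s one = f (loop_at w s).
Hypothesis gpt : forall w s t, w = point \/ s = zero \/ s = one -> g w s t = point.

Let cell_fun (t : I) (z : SO R Y) : Z :=
  qlift (fun p : Om R Y * I => g p.1 p.2 t) z.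

Let cell_funE t w s : cell_fun t (sg (w, s)) = g w s t.
Proof.
by rewrite /cell_fun [LHS]qliftE // => -[w1 s1] [w2 s2] /= [h1 h2]; rewrite !gpt.
Qed.

Let cell_fun_pt t : cell_fun t point = point.
Proof. by rewrite -[X in cell_fun t X](@sg_pt (Om R Y) point zero) ?cell_funE ?gpt; auto. Qed.

Let cell_fun_continuous : continuous (fun p : SO R Y * I => cell_fun p.2 p.1).
Proof.
have [_ q] := is_quotient_prod (compact_hausdorff_I01 R)
  (@is_quotient_qpi (Om R Y * I)%type
     (fun p q => (p.1 = point \/ p.2 = zero \/ p.2 = one) /\
                 (q.1 = point \/ q.2 = zero \/ q.2 = one))).
apply/continuousP => U oU; apply: q.
have cg : continuous (fun p : (Om R Y * I) * I => g p.1.1 p.1.2 p.2).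
  apply: compactly_generated_continuous.
    do 2 apply: compactly_generated_prod (compact_hausdorff_I01 R) _.
    exact: compactly_generated_kify.
  by move=> K c chK cc; apply: g_cts => //; continuity.
have /continuousP/(_ _ oU) := cg.
by congr open; apply/seteqP; split => -[[w s] t] /=; rewrite -/(sg (w, s)) cell_funE.
Qed.

Let cell_fun_hs_compat (p q : SO R Y * simplex R 1) :
  p.1 = point /\ q.1 = point ->
  cell_fun (edge_coord p.2) p.1 = cell_fun (edge_coord q.2) q.1.
Proof. by move=> [-> ->]; rewrite !cell_fun_pt. Qed.

Let cells : hsmash (SO R Y) (simplex R 1) -> Z :=
  qlift (fun p : SO R Y * simplex R 1 => cell_fun (edge_coord p.2) p.1).

Let cellsE z t : cells (hs (z, t)) = cell_fun (edge_coord t) z.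
Proof. by rewrite /cells [LHS](qliftE cell_fun_hs_compat). Qed.

Let cells_continuous : continuous cells.
Proof.
apply: (qlift_continuous cell_fun_hs_compat).
have ce : continuous (fun p : SO R Y * simplex R 1 => (p.1, edge_coord p.2)).
  have cf := edge_coord_continuous.
  by continuity.
exact: (continuous_compose ce cell_fun_continuous).
Qed.

Let cells_glue x y : glue_rel (S := stages R (Lambda R X) 0) x y -> f x = cells y.
Proof.
move=> [i [a [t [-> ->]]]]; rewrite hs_prE cellsE.
move: a; apply: Sg_ind => w s; rewrite cell_funE.
case: i => -[|[|//]] i2.
  have -> : Ordinal i2 = ord0 by exact/val_inj.
  by rewrite coface_edge1 edge_coordK g1 /= [X in f X]evE.
have -> : Ordinal i2 = ord_max by exact/val_inj.
by rewrite coface_edge0 edge_coordK g0 /= [X in f X]Sg_mapE.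
Qed.

(** The values on cells need to be continuous on compact Hausdorff families only,
    since the product of the loop space with two intervals is compactly generated.
    They descend to the suspension, and then to the half-smash product, because
    the quotient map to the suspension remains one after multiplication with the
    interval. *)
Lemma first_stage_rec : exists F : ptmap M Z,
  (forall y, F (vertex_incl y) = f y) /\ forall w s t, F (cell w s t) = g w s t.
Proof.
exists (att_lift cells_continuous cells_glue); split=> [y|w s t].
  exact: att_lift1.
by rewrite /cell [LHS]att_lift2 cellsE cell_funE edge_coordK.
Qed.

End Rec.

End FirstStage.

(** * Path fibrations, fibres and mapping cones *)

Section Fibrations.
Context {R : realType}.
Notation I := (I01 R).

Section Total.
Variables (A X : ptopologicalType) (f : ptmap A X).

Definition fib_base (g : fib_total R f) : A := (val (g : psub (fib_set_pt R f))).1.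

Definition fib_path (g : fib_total R f) : fpath R X :=
  (val (g : psub (fib_set_pt R f))).2.

Definition mk_fib (a : A) (w : fpath R X) : fib_total R f :=
  if pselect (fib_set f (a, w)) is left h then
    (exist _ (a, w) (mem_set h) : psub (fib_set_pt R f))
  else point.

Lemma fib_pathP g : f (fib_base g) = path_at (fib_path g) zero.
Proof. exact: (set_mem (valP (g : psub (fib_set_pt R f)))). Qed.

Lemma fib_base_mk a w : f a = path_at w zero -> fib_base (mk_fib a w) = a.
Proof. by move=> h; rewrite /mk_fib; case: pselect. Qed.

Lemma fib_path_mk a w : f a = path_at w zero -> fib_path (mk_fib a w) = w.
Proof. by move=> h; rewrite /mk_fib; case: pselect. Qed.

Lemma fib_projE g : fib_proj R f g = path_at (fib_path g) one.
Proof. by []. Qed.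

Lemma fib_eqP g g' :
  fib_base g = fib_base g' -> fib_path g = fib_path g' -> g = g'.
Proof.
move=> h1 h2; apply: (@val_inj _ _ (set_type (fib_set f))).
by rewrite [LHS]surjective_pairing [RHS]surjective_pairing; congr (_, _).
Qed.

Lemma fib_base_continuous : continuous fib_base.
Proof.
apply: continuous_fst; refine (continuous_compose _ (@set_val_continuous _ _)).
exact: unkify_continuous.
Qed.

Lemma fib_path_continuous : continuous fib_path.
Proof.
apply: continuous_snd; refine (continuous_compose _ (@set_val_continuous _ _)).
exact: unkify_continuous.
Qed.

Lemma mk_fib_continuous (K : topologicalType) (a : K -> A) (w : K -> fpath R X) :
  compact_hausdorff K -> continuous a -> continuous w ->
  (forall k, f (a k) = path_at (w k) zero) ->
  continuous (fun k => mk_fib (a k) (w k)).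
Proof.
move=> chK ca cw aw; apply: continuous_to_kify => //.
apply: (@continuous_to_set_type _ _ (fib_set f)).
have -> : (fun k => val (mk_fib (a k) (w k) : set_type (fib_set f))) =
    (fun k => (a k, w k)).
  by apply/funext => k; rewrite /mk_fib; case: pselect => // -[]; exact: aw.
exact: pair_continuous.
Qed.

(** The homotopy inverse of [fib_base]. *)
Definition fib_section (a : A) : fib_total R f := mk_fib a (mk_fpath (fun _ => f a)).

Lemma fib_section_path a :
  f a = path_at (mk_fpath (fun _ : I => f a)) zero.
Proof. by rewrite path_at_mk //; exact: continuous_cst. Qed.

Lemma fib_proj_section a : fib_proj R f (fib_section a) = f a.
Proof.
rewrite fib_projE fib_path_mk; last exact: fib_section_path.
by rewrite path_at_mk //; exact: continuous_cst.
Qed.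

Lemma fib_section_pt : fib_section point = point.
Proof.
apply: fib_eqP; first by rewrite fib_base_mk //; exact: fib_section_path.
rewrite fib_path_mk; last exact: fib_section_path.
by apply: fpath_eqP => t; rewrite path_at_mk ?pfun_pt //; exact: continuous_cst.
Qed.

Lemma fib_section_continuous (K : topologicalType) (a : K -> A) :
  compact_hausdorff K -> continuous a -> continuous (fun k => fib_section (a k)).
Proof.
move=> chK ca; apply: mk_fib_continuous => //; last by move=> k; exact: fib_section_path.
by apply: mk_fpath_continuous; continuity.
Qed.

Lemma fib_path_homotopic (h : ptmap (fib_total R f) A) :
  (forall g, h g = fib_base g) -> phomotopic R (ptcomp f h) (fib_proj R f).
Proof.
move=> hE; have cp := fib_path_continuous.
apply: (@phomotopic_of_paths R _ _ _ _ (@PtMap _ (fpath R X) fib_path cp erefl)) => g //=.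
by rewrite hE fib_pathP.
Qed.
End Total.

Section FiberPoints.
Variables (G X : ptopologicalType) (p : ptmap G X).

Definition mk_fiber (g : G) : fiber p :=
  if pselect (p g = point) is left h then
    (exist _ g (mem_set (h : [set g | p g = point] g)) :
       @psub G [set g | p g = point] (pfun_pt p))
  else point.

Lemma fiber_incl_mk g : p g = point -> fiber_incl p (mk_fiber g) = g.
Proof. by move=> h; rewrite /mk_fiber; case: pselect. Qed.

Lemma fiber_eqP z z' : fiber_incl p z = fiber_incl p z' -> z = z'.
Proof. by move=> h; apply: (@val_inj _ _ (set_type [set g | p g = point])). Qed.

Lemma mk_fiber_continuous (K : topologicalType) (g : K -> G) :
  compact_hausdorff K -> continuous g -> (forall k, p (g k) = point) ->
  continuous (fun k => mk_fiber (g k)).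
Proof.
move=> chK cg gp; apply: continuous_to_kify => //.
apply: (@continuous_to_set_type _ _ [set g | p g = point]).
have -> // : (fun k => val (mk_fiber (g k) : set_type [set g | p g = point])) = g.
by apply/funext => k; rewrite /mk_fiber; case: pselect => // -[]; exact: gp.
Qed.
End FiberPoints.

Section MappingCone.
Variables (F G : ptopologicalType) (f : ptmap F G).

Definition cone_base : ptmap G (mcone R f) := att1_ptmap _.

Definition cone_point (a : F) (t : I) : mcone R f := att2 _ (cn (a, t)).

Lemma cone_point_zero a : cone_point a zero = cone_base (f a).
Proof. by symmetry; apply: att_glue; exists a. Qed.

Lemma cone_point_pt a t : a = point \/ t = one -> cone_point a t = point.
Proof.
move=> h; transitivity (cone_point point zero); last first.
  by rewrite cone_point_zero pfun_pt.
by congr att2; apply: qpi_eq; split => //=; left.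
Qed.

Lemma cone_point_continuous (K : topologicalType) (a : K -> F) (t : K -> I) :
  continuous a -> continuous t -> continuous (fun k => cone_point (a k) (t k)).
Proof.
move=> ca ct; refine (continuous_compose _ (@att2_continuous _ _ _)).
exact: (continuous_compose (pair_continuous ca ct) (@qpi_continuous _ _)).
Qed.

Lemma mcone_ind (P : mcone R f -> Prop) :
  (forall g, P (cone_base g)) -> (forall a t, P (cone_point a t)) -> forall c, P c.
Proof.
move=> Pg Pa; apply: quot_ind => -[[] x]; first exact: Pg.
by move: x; apply: quot_ind => -[a t]; exact: Pa.
Qed.

Lemma mcone_rec (Z : ptopologicalType) (h : ptmap G Z) (k : F -> I -> Z) :
  continuous (fun p : F * I => k p.1 p.2) ->
  (forall a, k a zero = h (f a)) ->
  (forall a t, a = point \/ t = one -> k a t = point) ->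
  exists H : ptmap (mcone R f) Z,
    (forall g, H (cone_base g) = h g) /\ forall a t, H (cone_point a t) = k a t.
Proof.
move=> ck k0 kpt.
have kc (p q : F * I) : (p.1 = point \/ p.2 = one) /\ (q.1 = point \/ q.2 = one) ->
    k p.1 p.2 = k q.1 q.2.
  by move=> [hp hq]; rewrite !kpt.
pose kl : cone R F -> Z := qlift (fun p : F * I => k p.1 p.2).
have klE a t : kl (cn (a, t)) = k a t by exact: (qliftE kc).
have ckl : continuous kl := qlift_continuous kc ck.
have glue g c : (exists a, g = f a /\ c = cn (a, zero)) -> h g = kl c.
  by move=> [a [-> ->]]; rewrite klE k0.
exists (att_lift ckl glue); split=> [g|a t]; first exact: att_lift1.
by rewrite [LHS]att_lift2 klE.
Qed.
End MappingCone.

End Fibrations.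

(** * From the first stage to the second Ganea space *)

Section ToGanea.
Context {R : realType}.
Notation I := (I01 R).
Variable X : ptopologicalType.
Notation Y := (SO R X).
Notation G1 := (fib_total R (ev R X)).
Notation p1 := (fib_proj R (ev R X)).
Notation C := (mcone R (fiber_incl p1)).
Notation p' := (ganea_cone_map R p1).
Notation G2 := (fib_total R p').

Lemma ganea_cone_map_base g : p' (cone_base (fiber_incl p1) g) = p1 g.
Proof. exact: att_lift1. Qed.

Lemma ganea_cone_map_point a t : p' (cone_point (fiber_incl p1) a t) = point.
Proof. exact: att_lift2. Qed.

Definition unit_loop (a : Om R X) : Om R Y := mk_loop (fun s => sg (a, s) : Y).

Lemma unit_loop_family (K : topologicalType) (a : K -> Om R X) :
  compact_hausdorff K -> continuous a ->
  (forall k, is_loop (fun s => sg (a k, s) : Y)) /\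
  continuous (fun k => unit_loop (a k)).
Proof.
move=> chK ca; apply: (mk_loop_continuous (F := fun k s => sg (a k, s) : Y)) => //.
- refine (continuous_compose _ (@qpi_continuous _ _)).
  by continuity.
- by move=> k; apply: sg_pt; auto.
- by move=> k; apply: sg_pt; auto.
Qed.

Lemma unit_loopE a s : loop_at (unit_loop a) s = sg (a, s) :> Y.
Proof.
have [h _] := unit_loop_family (compact_hausdorff_I01 R) (@continuous_cst I _ a).
exact: (loop_at_mk _ (h zero)).
Qed.

Lemma Om_mapE (A B : ptopologicalType) (f : ptmap A B) w t :
  loop_at (Om_map R f w) t = f (loop_at w t).
Proof. by []. Qed.

(** From the point of [X] under [b] at time [s] back along the loop under [b],
    covering the fraction [h] of the way to the base point. *)
Definition tail_path (b : Om R Y) (s h : R) : fpath R X :=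
  mk_fpath (fun r : I => ev R X (loop_at b (clamp (s * (1 - h * val r))))).

Lemma tail_path_cts b (s h : R) :
  continuous (fun r : I => ev R X (loop_at b (clamp (s * (1 - h * val r))))).
Proof.
have cv := @I01_val_continuous R.
by continuity.
Qed.

Definition tail_fib (b : Om R Y) (s h : R) : G1 :=
  mk_fib (ev R X) (loop_at b (clamp s)) (tail_path b s h).

Lemma tail_fib_match b s h :
  ev R X (loop_at b (clamp s)) = path_at (tail_path b s h) zero.
Proof.
by rewrite path_at_mk ?mulr0 ?subr0 ?mulr1 //; exact: tail_path_cts.
Qed.

Lemma tail_fib_proj b s h :
  p1 (tail_fib b s h) = ev R X (loop_at b (clamp (s * (1 - h)))).
Proof.
rewrite fib_projE fib_path_mk; last exact: tail_fib_match.
by rewrite path_at_mk ?mulr1 //; exact: tail_path_cts.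
Qed.

Lemma tail_fib1 b s : p1 (tail_fib b s 1) = point.
Proof. by rewrite tail_fib_proj subrr mulr0 clamp0 loop_at0 pfun_pt. Qed.

Lemma tail_fib_ext b b' s h :
  loop_at b (clamp s) = loop_at b' (clamp s) ->
  (forall t, ev R X (loop_at b t) = ev R X (loop_at b' t)) ->
  tail_fib b s h = tail_fib b' s h.
Proof.
move=> bs bb; rewrite /tail_fib bs; congr mk_fib.
by congr mk_fpath; apply/funext => r; exact: bb.
Qed.

Lemma tail_fib_pt b s h :
  (forall u, loop_at b (clamp (s * u)) = point) -> tail_fib b s h = point.
Proof.
move=> bu; apply: fib_eqP.
  by rewrite fib_base_mk; [have := bu 1; rewrite mulr1|exact: tail_fib_match].
rewrite fib_path_mk; last exact: tail_fib_match.
apply: fpath_eqP => t; rewrite path_at_mk ?bu ?pfun_pt //; exact: tail_path_cts.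
Qed.

Lemma tail_fib0 b s : tail_fib b s 0 = fib_section (ev R X) (loop_at b (clamp s)).
Proof.
congr mk_fib; congr mk_fpath; apply/funext => r.
by rewrite mul0r subr0 mulr1.
Qed.

Lemma tail_fib_continuous (K : topologicalType) (b : K -> Om R Y) (s h : K -> R) :
  compact_hausdorff K -> continuous b -> continuous s -> continuous h ->
  continuous (fun k => tail_fib (b k) (s k) (h k)).
Proof.
move=> chK cb cs ch; apply: mk_fib_continuous => //.
- by continuity.
- apply: mk_fpath_continuous.
  have cv := @I01_val_continuous R.
  by continuity.
- by move=> k; exact: tail_fib_match.
Qed.

(** Up to height [1] the path to the base point grows, and the point reaches the
    fibre; from height [1] to height [2] it climbs the cone over the fibre. *)
Definition climb (b : Om R Y) (s h : R) : C :=
  if h <= 1 then cone_base _ (tail_fib b s h)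
  else cone_point _ (mk_fiber p1 (tail_fib b s 1)) (clamp (h - 1)).

Lemma climb_continuous (K : topologicalType) (b : K -> Om R Y) (s h : K -> R) :
  compact_hausdorff K -> continuous b -> continuous s -> continuous h ->
  continuous (fun k => climb (b k) (s k) (h k)).
Proof.
move=> chK cb cs ch.
have c1 : continuous (fun _ : K => 1 : R) := @continuous_cst _ _ _.
have chA A (cA : closed A) := compact_hausdorff_set_type chK cA.
have cv (A : set K) := @set_val_continuous _ A.
apply: (@if_le_continuous R _ _ h (fun _ => 1)
  (fun k => cone_base _ (tail_fib (b k) (s k) (h k)))
  (fun k => cone_point _ (mk_fiber p1 (tail_fib (b k) (s k) 1)) (clamp (h k - 1)))) => //.
- refine (continuous_compose _ (pfun_cts _)).
  apply: tail_fib_continuous; first exact/chA/closed_le_fun.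
  + by continuity.
  + by continuity.
  + by continuity.
- apply: cone_point_continuous; last by continuity.
  apply: mk_fiber_continuous; first exact/chA/closed_le_fun.
    apply: tail_fib_continuous; first exact/chA/closed_le_fun.
    + by continuity.
    + by continuity.
    + by continuity.
  by move=> k; exact: tail_fib1.
- move=> k ->; rewrite subrr clamp0 cone_point_zero fiber_incl_mk //; exact: tail_fib1.
Qed.

Lemma climb0 b s : climb b s 0 = cone_base _ (fib_section (ev R X) (loop_at b (clamp s))).
Proof. by rewrite /climb ler01 tail_fib0. Qed.

(** What is seen of the loop, apart from its position, is its image in [X]. *)
Lemma climb_ext b b' s h :
  loop_at b (clamp s) = loop_at b' (clamp s) ->
  (forall t, ev R X (loop_at b t) = ev R X (loop_at b' t)) ->
  climb b s h = climb b' s h.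
Proof. by move=> h1 h2; rewrite /climb !(tail_fib_ext _ h1 h2). Qed.

Lemma climb_pt b s h :
  (forall u, loop_at b (clamp (s * u)) = point) -> climb b s h = point.
Proof.
move=> bu; rewrite /climb !tail_fib_pt // pfun_pt.
case: ifP => // _; apply: cone_point_pt; left.
by apply: fiber_eqP; rewrite fiber_incl_mk ?pfun_pt.
Qed.

Lemma climb2 b s : climb b s 2 = point.
Proof.
rewrite /climb ifF; last by apply/negbTE; rewrite -ltNge; lra.
by apply: cone_point_pt; right; apply: clamp_ge1; lra.
Qed.

Lemma ganea_cone_map_climb b s h :
  p' (climb b s h) = ev R X (loop_at b (clamp (s * (1 - Num.min 1 h)))).
Proof.
rewrite /climb; case: ifPn => h1.
  by rewrite ganea_cone_map_base tail_fib_proj (min_idPr h1).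
rewrite ganea_cone_map_point min_l; last by apply/ltW; rewrite ltNge.
by rewrite subrr mulr0 clamp0 loop_at0 pfun_pt.
Qed.

(** For [t = 0] the position is [s] and the height is [0]. For [t = 1] the point is
    at the vertex of the cone if [s <= 1 / 2], and at position [1] otherwise. For
    [s = 0] the position stays [0], and for [s = 1] it stays [1] at height [0], so
    that the ends of the suspension coordinate go to the base point throughout. *)
Definition half_pos (s t : R) : R := Num.min 1 (s * (1 + t)).
Definition half_height (s t : R) : R := 2 * Num.min t (2 * (1 - s)).
Definition half_cell (b : Om R Y) (s t : R) : C :=
  climb b (half_pos s t) (half_height s t).

Lemma half_cell_continuous (K : topologicalType) (b : K -> Om R Y) (s t : K -> R) :
  compact_hausdorff K -> continuous b -> continuous s -> continuous t ->
  continuous (fun k => half_cell (b k) (s k) (t k)).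
Proof.
move=> chK cb cs ct; apply: climb_continuous => //.
  by rewrite /half_pos; continuity.
by rewrite /half_height; continuity.
Qed.

Definition fold_coord (t : I) : R := Num.min (2 * val t) (2 - 2 * val t).

Definition ganea_cell (w : Om R Y) (s t : I) : C :=
  if val t <= 1 / 2 then half_cell (unit_loop (Om_map R (ev R X) w)) (val s) (fold_coord t)
  else half_cell w (val s) (fold_coord t).

Lemma unit_loop_ev w t :
  ev R X (loop_at (unit_loop (Om_map R (ev R X) w)) t) = ev R X (loop_at w t).
Proof. by rewrite unit_loopE ev_sg. Qed.

(** For [s <= 1 / 2] both halves have reached the vertex of the cone; beyond, they
    are at the ends of loops that lie over the same loop in [X]. *)
Lemma half_cell_meet w (s : R) : s <= 1 ->
  half_cell (unit_loop (Om_map R (ev R X) w)) s 1 = half_cell w s 1.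
Proof.
move=> s1; rewrite /half_cell /half_height /half_pos.
have [sh|sh] := leP s (1 / 2).
  have -> : Num.min 1 (2 * (1 - s)) = 1 :> R by rewrite min_l //; lra.
  by rewrite mulr1 !climb2.
have -> : Num.min 1 (s * (1 + 1)) = 1 :> R by rewrite min_l //; lra.
by apply: climb_ext => [|t]; [rewrite clamp1 !loop_at1|exact: unit_loop_ev].
Qed.

Lemma ganea_cell_continuous (K : topologicalType) (w : K -> Om R Y) (s t : K -> I) :
  compact_hausdorff K -> continuous w -> continuous s -> continuous t ->
  continuous (fun k => ganea_cell (w k) (s k) (t k)).
Proof.
move=> chK cw cs ct.
have chA A (cA : closed A) := compact_hausdorff_set_type chK cA.
have cv (A : set K) := @set_val_continuous _ A.
have cvt : continuous (fun k => val (t k) : R) by exact: continuous_val.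
have cvs : continuous (fun k => val (s k) : R) by exact: continuous_val.
have c1 : continuous (fun _ : K => 1 / 2 : R) := @continuous_cst _ _ _.
have cf : continuous (fun k => fold_coord (t k)) by rewrite /fold_coord; continuity.
apply: (@if_le_continuous R _ _ (fun k => val (t k)) (fun _ => 1 / 2)
  (fun k => half_cell (unit_loop (Om_map R (ev R X) (w k))) (val (s k)) (fold_coord (t k)))
  (fun k => half_cell (w k) (val (s k)) (fold_coord (t k)))) => //.
- have chA1 := chA _ (closed_le_fun cvt c1).
  apply: half_cell_continuous => //; first apply: (unit_loop_family _ _).2 => //.
  + by refine (continuous_compose _ (pfun_cts (Om_map R (ev R X)))); continuity.
  + exact: (continuous_compose (@cv _) cvs).
  + exact: (continuous_compose (@cv _) cf).
- have chA1 := chA _ (closed_le_fun c1 cvt).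
  apply: half_cell_continuous => //.
  + by continuity.
  + exact: (continuous_compose (@cv _) cvs).
  + exact: (continuous_compose (@cv _) cf).
- move=> k tk; rewrite /fold_coord tk.
  have -> : Num.min (2 * (1 / 2)) (2 - 2 * (1 / 2)) = 1 :> R.
    by rewrite min_l; [field|lra].
  exact/half_cell_meet/I01_le1.
Qed.

Lemma fold_coord_ge0 t : 0 <= fold_coord t.
Proof. by rewrite le_min; have := I01_ge0 t; have := I01_le1 t; lra. Qed.

Lemma half_cell0 b (s : I) :
  half_cell b (val s) 0 = cone_base _ (fib_section (ev R X) (loop_at b s)).
Proof.
have s1 := I01_le1 s.
rewrite /half_cell /half_height /half_pos addr0 mulr1 min_r // min_l; last by lra.
by rewrite mulr0 climb0 clamp_val.
Qed.

Lemma fold_coord0 : fold_coord zero = 0.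
Proof. by rewrite /fold_coord /= min_l; lra. Qed.

Lemma fold_coord1 : fold_coord one = 0.
Proof. by rewrite /fold_coord /= min_r; lra. Qed.

Lemma half_pos0 t : half_pos 0 t = 0.
Proof. by rewrite /half_pos mul0r min_r. Qed.

Lemma half_pos1 t : 0 <= t -> half_pos 1 t = 1.
Proof. by move=> t0; rewrite /half_pos min_l //; lra. Qed.

Lemma half_height1 t : 0 <= t -> half_height 1 t = 0.
Proof. by move=> t0; rewrite /half_height subrr mulr0 min_r // mulr0. Qed.

Lemma half_cell_pt b (s t : I) :
  (forall u, loop_at b u = point) \/ s = zero \/ s = one ->
  half_cell b (val s) (fold_coord t) = point.
Proof.
have t0 := fold_coord_ge0 t.
case=> [b0|[->|->]]; first by apply: climb_pt.
  apply: climb_pt => u; rewrite half_pos0 mul0r clamp0; by rewrite loop_at0.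
rewrite /half_cell half_pos1 // half_height1 // climb0 clamp1 loop_at1.
by rewrite fib_section_pt pfun_pt.
Qed.

Lemma ganea_cell_zero w s :
  ganea_cell w s zero = cone_base _ (fib_section (ev R X) (sg (Om_map R (ev R X) w, s))).
Proof.
have h : val (zero : I) <= 1 / 2 :> R by rewrite -[val _]/(0 : R); lra.
by rewrite /ganea_cell h fold_coord0 half_cell0 unit_loopE.
Qed.

Lemma ganea_cell_one w s :
  ganea_cell w s one = cone_base _ (fib_section (ev R X) (loop_at w s)).
Proof.
have h : (val (one : I) <= 1 / 2 :> R) = false.
  by apply/negbTE; rewrite -ltNge -[val _]/(1 : R); lra.
by rewrite /ganea_cell h fold_coord1 half_cell0.
Qed.

Lemma ganea_cell_pt w s t :
  w = point \/ s = zero \/ s = one -> ganea_cell w s t = point.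
Proof.
move=> h; rewrite /ganea_cell; case: ifP => _; apply: half_cell_pt.
  case: h => [->|]; [left=> u|by right].
  by rewrite unit_loopE pfun_pt sg_pt //; left.
by case: h => [->|]; [left|right].
Qed.

Lemma compactly_generated_SO (Z : ptopologicalType) : compactly_generated (SO R Z).
Proof.
move=> U kU; apply: (is_quotient_qpi _).2.
apply: (compactly_generated_prod (compact_hausdorff_I01 R)
  (@compactly_generated_kify _)) => K f cK hK cf.
by apply: (kU K (@qpi _ _ \o f)) => //; exact: (continuous_compose cf (@qpi_continuous _ _)).
Qed.

(** The time on the loop under [w] to which a point of the cell is moved; the
    linear homotopy back to [s] proves that the map is one over [X]. *)
Definition cell_shift (s : R) (t : R) : R :=
  half_pos s t * (1 - Num.min 1 (half_height s t)).

Lemma ganea_cone_map_cell w s t :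
  p' (ganea_cell w s t) = ev R X (loop_at w (clamp (cell_shift (val s) (fold_coord t)))).
Proof.
by rewrite /ganea_cell; case: ifP => _; rewrite ganea_cone_map_climb ?unit_loop_ev.
Qed.

Lemma first_stage_to_ganea :
  exists f : ptmap (realization R (Lambda R X) 1) G2,
    phomotopic R (ptcomp (fib_proj R p') f) (realization_map R (Lambda R X) 1).
Proof.
pose j (y : Y) : G2 :=
  fib_section p' (cone_base (fiber_incl p1) (fib_section (ev R X) y)).
have cj : continuous j.
  apply: compactly_generated_continuous; first exact: compactly_generated_SO.
  move=> K c chK cc; apply: fib_section_continuous => //.
  refine (continuous_compose _ (pfun_cts _)).
  exact: fib_section_continuous.
have jpt : j point = point by rewrite /j fib_section_pt pfun_pt fib_section_pt.
have [||||f [fY fC]] := @first_stage_rec R X G2 (PtMap cj jpt)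
  (fun w s t => fib_section p' (ganea_cell w s t)).
- move=> K w s t chK cw cs ct; apply: fib_section_continuous => //.
  exact: ganea_cell_continuous.
- by move=> w s; rewrite ganea_cell_zero.
- by move=> w s; rewrite ganea_cell_one.
- by move=> w s t h; rewrite ganea_cell_pt ?fib_section_pt.
exists f.
have sh0 (s : I) : cell_shift (val s) 0 = val s.
  have s1 := I01_le1 s; rewrite /cell_shift /half_pos /half_height.
  by rewrite addr0 mulr1 min_r // [Num.min 0 _]min_l ?mulr0 ?min_r ?subr0 ?mulr1 //; lra.
pose slide w (s t v : I) : X := ev R X (loop_at w
  (clamp ((1 - val v) * cell_shift (val s) (fold_coord t) + val v * val s))).
have cslide (K : topologicalType) (w : K -> Om R Y) (s t v : K -> I) :
    continuous w -> continuous s -> continuous t -> continuous v ->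
    continuous (fun k => slide (w k) (s k) (t k) (v k)).
  move=> cw cs ct cv.
  have cvt : continuous (fun k => val (t k) : R) by exact: continuous_val.
  have cvs : continuous (fun k => val (s k) : R) by exact: continuous_val.
  have cvv : continuous (fun k => val (v k) : R) by exact: continuous_val.
  rewrite /slide /cell_shift /fold_coord /half_pos /half_height; by continuity.
have slideE w s t v : path_at (mk_fpath (slide w s t)) v = slide w s t v.
  by apply: path_at_mk; apply: cslide; continuity.
have ck : continuous (fun y : Y => mk_fpath (fun _ : I => ev R X y)).
  by apply: mk_fpath_continuous; continuity.
have kE (y : Y) v : path_at (mk_fpath (fun _ : I => ev R X y)) v = ev R X y.
  by rewrite path_at_mk //; exact: continuous_cst.
have kpt : mk_fpath (fun _ : I => ev R X point) = point.
  by apply: fpath_eqP => v; rewrite kE pfun_pt.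
have [||||H [HY HC]] := @first_stage_rec R X (fpath R X) (PtMap ck kpt)
  (fun w s t => mk_fpath (slide w s t)).
- move=> K w s t chK cw cs ct; apply: mk_fpath_continuous.
  by apply: cslide; continuity.
- move=> w s; apply: fpath_eqP => v; rewrite slideE [RHS]kE ev_sg /slide.
  by rewrite fold_coord0 sh0 -mulrDl subrK mul1r clamp_val.
- move=> w s; apply: fpath_eqP => v; rewrite slideE [RHS]kE /slide.
  by rewrite fold_coord1 sh0 -mulrDl subrK mul1r clamp_val.
- move=> w s t h; apply: fpath_eqP => v; rewrite slideE /slide.
  have t0 := fold_coord_ge0 t.
  case: h => [->|[->|->]]; first by rewrite pfun_pt.
    by rewrite /cell_shift half_pos0 mul0r !mulr0 addr0 clamp0 loop_at0 pfun_pt.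
  rewrite /cell_shift half_pos1 // half_height1 // [Num.min 1 0]min_r // subr0.
  by rewrite !mulr1 subrK clamp1 loop_at1 pfun_pt.
apply: (@phomotopic_of_paths R _ _ _ _ H); apply: first_stage_ind => [y|w s t].
- rewrite HY kE /= fY.
  by rewrite [RHS]fib_proj_section ganea_cone_map_base fib_proj_section.
- rewrite HC slideE /= fC.
  rewrite [RHS]fib_proj_section ganea_cone_map_cell /slide.
  by rewrite val_zero subr0 mul1r mul0r addr0.
- by rewrite HY kE realization_map_vertex.
- by rewrite HC slideE realization_map_cell /slide val_one subrr mul0r add0r mul1r clamp_val.
Qed.

End ToGanea.

(** * Continuity on the fibre of the first Ganea map *)

(** Where [f] and [g] differ, a compact neighbourhood [C] of [k] has an image under
    [f] that misses [g k]. This image is closed since [X] is weak Hausdorff, so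
    that [g] avoids it near [k]. *)
Lemma weak_hausdorff_equalizer (X K : topologicalType) (f g : K -> X) :
  weak_hausdorff X -> compact_hausdorff K -> continuous f -> continuous g ->
  closed [set k | f k = g k].
Proof.
move=> wX chK cf cg; rewrite -openC openE => k /= nfg.
have closed_pt (x : X) : closed [set x].
  have -> : [set x] = range (fun _ : K => x).
    by apply/seteqP; split=> [_ ->|_ [_ _ <-]] //; exists k.
  by apply: (wX K); [exact: chK.1|exact: chK.2|exact: continuous_cst].
have oV : open [set l | f l <> g k].
  have -> : [set l | f l <> g k] = f @^-1` (~` [set g k]) by [].
  by apply: open_comp => [l _|]; [exact: cf|exact/closed_openC].
have [C [D [cC oD Dk DC CV]]] := compact_hausdorff_nbhs chK oV nfg.
have cfC : closed (f @` C).
  have clC : closed C by exact: compact_closed chK.2 cC.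
  have chC := compact_hausdorff_set_type chK clC.
  have -> : f @` C = range (fun x : set_type C => f (val x)).
    apply/seteqP; split=> [_ [x Cx <-]|_ [x _ <-]].
      by exists (exist _ x (mem_set Cx)).
    by exists (val x) => //; exact: set_mem (valP x).
  apply: (wX (set_type C)); [exact: chC.1|exact: chC.2|].
  exact: (continuous_compose (@set_val_continuous _ _) cf).
have oW : open (g @^-1` (~` (f @` C))).
  by apply: open_comp => [l _|]; [exact: cg|exact/closed_openC].
have : nbhs k (D `&` g @^-1` (~` (f @` C))).
  apply: open_nbhs_nbhs; split; first exact: openI.
  by split=> // -[l Cl fl]; exact: (CV l Cl).
by apply: filterS => l [Dl ngl] fgl; apply: ngl; exists l => //; exact: DC.
Qed.

Section FiberTest.
Context {R : realType}.
Notation I := (I01 R).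
Variable X : ptopologicalType.
Notation Y := (SO R X).
Notation p1 := (fib_proj R (ev R X)).

(** The fibre is contained in the product of the quotient [Y] of [Om X * I] with
    the path space. For a compact Hausdorff family [z] in the fibre, the product
    of the quotient map with the identity of [K] is a quotient map, and the
    condition that loop and path match is closed upstairs, by
    [weak_hausdorff_equalizer]. So a set of pairs that satisfy it is closed if its
    preimage is, and this is what the test shows. *)
Lemma fiber_continuous_test (Z : topologicalType) (phi : Y -> fpath R X -> Z) :
  weak_hausdorff X ->
  (forall (K : topologicalType) (a : K -> Om R X) (s : K -> I) (c : K -> fpath R X),
     compact_hausdorff K -> continuous a -> continuous s -> continuous c ->
     (forall k, loop_at (a k) (s k) = path_at (c k) zero) ->
     (forall k, path_at (c k) one = point) ->
     continuous (fun k => phi (sg (a k, s k)) (c k))) ->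
  continuous (fun z : fiber p1 =>
    phi (fib_base (fiber_incl p1 z)) (fib_path (fiber_incl p1 z))).
Proof.
move=> wX test; apply: compactly_generated_continuous.
  exact: compactly_generated_kify.
move=> K z chK cz.
have ci : continuous (fun k => fiber_incl p1 (z k)).
  exact: (continuous_compose cz (pfun_cts (fiber_incl p1))).
pose y k := fib_base (fiber_incl p1 (z k)).
pose c k := fib_path (fiber_incl p1 (z k)).
have cy : continuous y := continuous_compose ci (@fib_base_continuous _ _ _ _).
have cc : continuous c := continuous_compose ci (@fib_path_continuous _ _ _ _).
have yc k : ev R X (y k) = path_at (c k) zero by exact: fib_pathP.
have c1 k : path_at (c k) one = point by exact: (fiber_inclP (z k)).
apply/continuous_closedP => D cD.
pose N : set (Y * K) :=
  [set q | ev R X q.1 = path_at (c q.2) zero /\ D (phi q.1 (c q.2))].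
suff cN : closed N.
  have -> : (fun k => phi (y k) (c k)) @^-1` D = (fun k => (y k, k)) @^-1` N.
    by apply/seteqP; split=> [k Dk|k []] //; split; [exact: yc|exact: Dk].
  have : continuous (fun k => (y k, k)) by continuity.
  by move/continuous_closedP; exact.
rewrite -openC.
apply: (is_quotient_prod chK (@is_quotient_qpi (Om R X * I)%type _)).2.
apply: (compactly_generated_prod chK (compactly_generated_prod
  (compact_hausdorff_I01 R) (@compactly_generated_kify _))) => L f cL hL cf.
have ca : continuous (fun l => (f l).1.1) by continuity.
have cs : continuous (fun l => (f l).1.2) by continuity.
have cl : continuous (fun l => c (f l).2) by continuity.
have chL : compact_hausdorff L by [].
pose E := [set l : L | loop_at (f l).1.1 (f l).1.2 = path_at (c (f l).2) zero].
have cE : closed E by apply: weak_hausdorff_equalizer => //; continuity.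
have ct : continuous (fun l : set_type E =>
    phi (sg ((f (val l)).1.1, (f (val l)).1.2)) (c (f (val l)).2)).
  apply: (test (set_type E)).
  - exact: compact_hausdorff_set_type.
  - exact: (continuous_compose (@set_val_continuous _ _) ca).
  - exact: (continuous_compose (@set_val_continuous _ _) cs).
  - exact: (continuous_compose (@set_val_continuous _ _) cl).
  - by move=> l; exact: (set_mem (valP l)).
  - by move=> l; exact: c1.
rewrite -closedC.
have -> : ~` (f @^-1` ((fun x : (Om R X * I) * K => (qpi _ x.1, x.2)) @^-1` (~` N))) =
    val @` ((fun l : set_type E =>
      phi (sg ((f (val l)).1.1, (f (val l)).1.2)) (c (f (val l)).2)) @^-1` D).
  have sgE (q : Om R X * I) : sg (q.1, q.2) = qpi _ q by case: q.
  apply/seteqP; split=> [l /= /contrapT [h1 h2]|_ [l Dl <-]].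
    have El : E l by rewrite /E /= -h1 -sgE [RHS]evE.
    by exists (exist _ l (mem_set El)) => //=; rewrite sgE.
  apply; split; last by rewrite /= -sgE.
  by have El : E (val l) := set_mem (valP l); rewrite /= -sgE -El [LHS]evE.
apply: closed_set_val_image => //.
by move/continuous_closedP: ct; exact.
Qed.

End FiberTest.

(** * Contracting a neighbourhood of the base point *)

Section WellPointed.
Context {R : realType}.
Notation I := (I01 R).

(** The homotopy extension property, applied to the inclusion of [X] into [X] with
    a whisker at the base point, retracts [X * I] to this whiskered space. The
    function [u] is the distance of the image of [(x, one)] from the tip of the
    whisker. It is smaller than [1] only if this image lies on the whisker. *)
Lemma well_pointed_contraction (X : ptopologicalType) :
  well_pointed R X ->
  exists (u : X -> R) (h : X * I -> X),
  [/\ continuous u /\ continuous h,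
      forall x, 0 <= u x <= 1,
      u point = 0,
      (forall x, h (x, zero) = x) /\ (forall t, h (point, t) = point)
    & forall x, u x < 1 -> h (x, one) = point].
Proof.
move=> wX.
pose W := set_type [set p : X * I | p.2 = zero \/ p.1 = point].
pose f (x : X) : W := exist _ (x, zero) (mem_set (or_introl erefl)).
pose g (t : I) : W := exist _ (point, t) (mem_set (or_intror erefl)).
have cf : continuous f.
  apply: continuous_to_set_type.
  by apply: (@pair_continuous X X I (fun x => x) (fun _ => zero)); continuity.
have cg : continuous g.
  apply: continuous_to_set_type.
  by apply: (@pair_continuous I X I (fun _ => point) (fun t => t)); continuity.
have fg : g zero = f point by exact/val_inj.
have [H [cH H0 Hp]] := wX W f g cf cg fg.
have cvH : continuous (fun p => val (H p) : X * I).
  exact: (continuous_compose cH (@set_val_continuous _ _)).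
exists (fun x => 1 - val (val (H (x, one))).2), (fun p => (val (H p)).1); split.
- split; last exact: continuous_fst.
  apply: continuous_addr; first exact: continuous_cst.
  apply: continuous_oppr; apply: continuous_val; apply: continuous_snd.
  apply: (@continuous_compose _ _ _ (fun x => (x, one)) (fun p => val (H p))) => //.
  by continuity.
- by move=> x; have := I01_ge0 (val (H (x, one))).2; have := I01_le1 (val (H (x, one))).2; lra.
- by rewrite Hp val_one subrr.
- by split=> [x|t]; rewrite ?H0 ?Hp.
- move=> x u1; have [h0|//] : (val (H (x, one))).2 = zero \/ (val (H (x, one))).1 = point.
    exact: set_mem (valP (H (x, one))).
  by move: u1; rewrite h0 val_zero subr0 ltxx.
Qed.

(** Below the value [1] the deformation of [well_pointed_contraction] makes the
    whole loop constant. *)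
Definition loop_sup (X : ptopologicalType) (u : X -> R) (w : Om R X) : R :=
  sup (range (fun t : I => u (loop_at w t))).

Section LoopSup.
Variables (X : ptopologicalType) (u : X -> R).
Hypotheses (cu : continuous u) (u01 : forall x, 0 <= u x <= 1).

Lemma loop_sup_has (w : Om R X) : has_sup (range (fun t : I => u (loop_at w t))).
Proof.
split; first by exists (u (loop_at w zero)), zero.
by exists 1 => _ [t _ <-]; have /andP[] := u01 (loop_at w t).
Qed.

Lemma le_loop_sup w t : u (loop_at w t) <= loop_sup u w.
Proof. by apply: ub_le_sup; [exact: (loop_sup_has w).2|exists t]. Qed.

Lemma loop_sup_le w c : (forall t, u (loop_at w t) <= c) -> loop_sup u w <= c.
Proof.
by move=> uc; apply: ge_sup => [|_ [t _ <-]//]; exact: (loop_sup_has w).1.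
Qed.

Lemma loop_sup_continuous (T : topologicalType) (a : T -> Om R X) :
  continuous a -> continuous (fun k => loop_sup u (a k)).
Proof.
move=> ca k; apply/(@cvgrPdist_le R R^o) => e e0.
pose F l t := u (loop_at (a l) t).
have cF : continuous (fun p : T * I => `|F k p.2 - F p.1 p.2|).
  have cd : continuous (fun p : T * I => F k p.2 - F p.1 p.2).
    by rewrite /F; continuity.
  exact: (continuous_compose cd (@norm_continuous R R^o)).
pose W : set (T * I) := [set p | `|F k p.2 - F p.1 p.2| < e].
have oW : open W.
  have -> : W = (fun p : T * I => `|F k p.2 - F p.1 p.2|) @^-1` [set x | x < e] by [].
  by apply: open_comp => [p _|]; [exact: cF|exact: open_lt].
have oV := open_tube (@I01_compact R) oW.
have : nbhs k [set l | forall t, setT t -> W (l, t)].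
  by apply: open_nbhs_nbhs; split=> // t _; rewrite /W /= subrr normr0.
apply: filterS => l Wl.
have Wl' t : `|F k t - F l t| <= e by exact/ltW/(Wl t).
rewrite ler_distlC; apply/andP; split.
  rewrite lerBlDr; apply: loop_sup_le => t.
  have := le_loop_sup (a l) t; have := Wl' t; rewrite ler_distl /F; lra.
apply: loop_sup_le => t.
have := le_loop_sup (a k) t; have := Wl' t; rewrite ler_distl /F; lra.
Qed.

Lemma loop_sup_pt : u point = 0 -> loop_sup u point = 0.
Proof.
move=> u0; apply/le_anti/andP; split.
  by apply: loop_sup_le => t; rewrite -[loop_at _ _]/(point : X) u0.
have /andP[u0' _] := u01 (loop_at (point : Om R X) zero).
exact: le_trans u0' (le_loop_sup _ zero).
Qed.
End LoopSup.

End WellPointed.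

(** * From the second Ganea space to the first stage *)

Section FromGanea.
Context {R : realType}.
Notation I := (I01 R).
Variable X : ptopologicalType.
Notation Y := (SO R X).
Notation M := (realization R (Lambda R X) 1).
Notation G1 := (fib_total R (ev R X)).
Notation p1 := (fib_proj R (ev R X)).
Notation C := (mcone R (fiber_incl p1)).
Notation p' := (ganea_cone_map R p1).
Notation G2 := (fib_total R p').

(** The conditions on [g] concern matching loops and paths only, and for these the
    collapsed points of the suspension require the path to be a loop. *)
Lemma fiber_rec (Z : ptopologicalType) (g : Om R X -> I -> fpath R X -> Z) :
  weak_hausdorff X ->
  (forall (K : topologicalType) (a : K -> Om R X) (s : K -> I) (c : K -> fpath R X),
     compact_hausdorff K -> continuous a -> continuous s -> continuous c ->
     (forall k, loop_at (a k) (s k) = path_at (c k) zero) ->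
     (forall k, path_at (c k) one = point) ->
     continuous (fun k => g (a k) (s k) (c k))) ->
  (forall a s a' s' c,
     a = point \/ s = zero \/ s = one -> a' = point \/ s' = zero \/ s' = one ->
     path_at c zero = point -> path_at c one = point -> g a s c = g a' s' c) ->
  exists phi : fiber p1 -> Z, continuous phi /\
    forall z a s, fib_base (fiber_incl p1 z) = sg (a, s) ->
      phi z = g a s (fib_path (fiber_incl p1 z)).
Proof.
move=> wX test gpt.
pose G (c : fpath R X) (p : Om R X * I) : Z :=
  if pselect (loop_at p.1 p.2 = path_at c zero /\ path_at c one = point)
  then g p.1 p.2 c else point.
have base_pt (p : Om R X * I) :
    p.1 = point \/ p.2 = zero \/ p.2 = one -> loop_at p.1 p.2 = point.
  by case=> [->|[->|->]]; rewrite ?loop_at0 ?loop_at1.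
have Gpt c (p q : Om R X * I) :
    (p.1 = point \/ p.2 = zero \/ p.2 = one) /\
    (q.1 = point \/ q.2 = zero \/ q.2 = one) -> G c p = G c q.
  move=> [hp hq]; rewrite /G !base_pt //.
  by case: pselect => // -[c0 c1]; exact: gpt.
pose phi (y : Y) (c : fpath R X) : Z := qlift (G c) y.
have phiE w s c : phi (sg (w, s)) c = G c (w, s) by exact: (qliftE (Gpt c)).
exists (fun z => phi (fib_base (fiber_incl p1 z)) (fib_path (fiber_incl p1 z))).
split=> [|z a s zE].
  apply: fiber_continuous_test => // K a s c chK ca cs cc ac c1.
  have -> : (fun k => phi (sg (a k, s k)) (c k)) = (fun k => g (a k) (s k) (c k)).
    apply/funext => k; rewrite phiE /G; case: pselect => // -[].
    by split; [exact: ac|exact: c1].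
  exact: test.
rewrite zE phiE /G; case: pselect => // -[]; split.
  by have := fib_pathP (fiber_incl p1 z); rewrite zE ev_sg.
exact: (fiber_inclP z).
Qed.

(** ** Running along a loop and a path *)

Definition cat_path (v w : fpath R X) : fpath R X :=
  mk_fpath (fun t : I => if val t <= 1 / 2 then path_at v (clamp (2 * val t))
                         else path_at w (clamp (2 * val t - 1))).

Lemma cat_path_family (T : topologicalType) (v w : T -> fpath R X) (s : T -> I) :
  continuous v -> continuous w -> continuous s ->
  (forall k, path_at (v k) one = path_at (w k) zero) ->
  continuous (fun k => if val (s k) <= 1 / 2 then path_at (v k) (clamp (2 * val (s k)))
                       else path_at (w k) (clamp (2 * val (s k) - 1))).
Proof.
move=> cv cw cs vw.
have cvs : continuous (fun k => val (s k) : R) by exact: continuous_val.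
apply: (@if_le_continuous R _ _ (fun k => val (s k)) (fun _ => 1 / 2)
  (fun k => path_at (v k) (clamp (2 * val (s k))))
  (fun k => path_at (w k) (clamp (2 * val (s k) - 1)))) => //.
- exact: continuous_cst.
- apply: (continuous_compose (@set_val_continuous _ _)
    (g := fun k => path_at (v k) (clamp (2 * val (s k))))).
  by continuity.
- apply: (continuous_compose (@set_val_continuous _ _)
    (g := fun k => path_at (w k) (clamp (2 * val (s k) - 1)))).
  by continuity.
- move=> k ->; have -> : 2 * (1 / 2) = 1 :> R by field.
  by rewrite subrr clamp1 clamp0.
Qed.

Lemma cat_pathE v w t : path_at v one = path_at w zero ->
  path_at (cat_path v w) t = if val t <= 1 / 2 then path_at v (clamp (2 * val t))
                             else path_at w (clamp (2 * val t - 1)).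
Proof.
move=> vw; apply: path_at_mk.
by apply: (@cat_path_family I (fun _ => v) (fun _ => w) (fun t => t)); continuity.
Qed.

Lemma cat_path0 v w : path_at v one = path_at w zero ->
  path_at (cat_path v w) zero = path_at v zero.
Proof.
by move=> vw; rewrite cat_pathE // val_zero mulr0 clamp0 ifT //; lra.
Qed.

Lemma cat_path1 v w : path_at v one = path_at w zero ->
  path_at (cat_path v w) one = path_at w one.
Proof.
move=> vw; rewrite cat_pathE // val_one ifF; last by apply/negbTE; rewrite -ltNge; lra.
by rewrite clamp_ge1 //; lra.
Qed.

Lemma cat_path_continuous (T : topologicalType) (v w : T -> fpath R X) :
  continuous v -> continuous w ->
  (forall k, path_at (v k) one = path_at (w k) zero) ->
  continuous (fun k => cat_path (v k) (w k)).
Proof.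
move=> cv cw vw; apply: mk_fpath_continuous.
apply: (@cat_path_family (T * I)%type (fun p => v p.1) (fun p => w p.1) snd) => //.
- by continuity.
- by continuity.
- by continuity.
Qed.

(** The parameter [r] runs from [-1] to [1]: up to [0] along the initial segment of
    length [c] of the loop [a], then along the path [d]. All paths in [X] that occur
    below the null-homotopy are reparametrisations of this one. *)
Definition run (a : Om R X) (c : R) (d : fpath R X) (r : R) : X :=
  if r <= 0 then loop_at a (clamp (c * (1 + r))) else path_at d (clamp r).

Lemma run_continuous (T : topologicalType) (a : T -> Om R X) (c : T -> R)
    (d : T -> fpath R X) (r : T -> R) :
  continuous a -> continuous c -> continuous d -> continuous r ->
  (forall k, loop_at (a k) (clamp (c k)) = path_at (d k) zero) ->
  continuous (fun k => run (a k) (c k) (d k) (r k)).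
Proof.
move=> ca cc cd cr ad.
apply: (@if_le_continuous R _ _ r (fun _ => 0)
  (fun k => loop_at (a k) (clamp (c k * (1 + r k))))
  (fun k => path_at (d k) (clamp (r k)))) => //.
- exact: continuous_cst.
- apply: (continuous_compose (@set_val_continuous _ _)
    (g := fun k => loop_at (a k) (clamp (c k * (1 + r k))))).
  by continuity.
- apply: (continuous_compose (@set_val_continuous _ _)
    (g := fun k => path_at (d k) (clamp (r k)))).
  by continuity.
- by move=> k ->; rewrite addr0 mulr1 clamp0.
Qed.

Lemma run_end a c d : path_at d one = point -> run a c d 1 = point.
Proof.
by move=> d1; rewrite /run ifF ?clamp1 //; apply/negbTE; rewrite -ltNge.
Qed.

Lemma run_start a c d : run a c d (-1) = point.
Proof. by rewrite /run ifT ?subrr ?mulr0 ?clamp0 ?loop_at0 //; lra. Qed.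

(** A parameter for [run] that starts at [0] and ends at [1]. For [v = 0] it goes
    back to [-1] before, so that the segment of [a] is traversed back and forth.
    For [v = 1] it waits at [0] instead. *)
Definition reel (v u : I) : R :=
  Num.max (- (2 * (1 - val v) * val u)) (4 * val u - 3).

Definition run_loop (a : Om R X) (c : R) (d : fpath R X) : Om R X :=
  mk_loop (fun t : I => run a c d (2 * val t - 1)).

Definition reel_loop (a : Om R X) (d : fpath R X) (v : I) : Om R X :=
  mk_loop (fun t : I => run a 1 d (reel v t)).

Lemma reel_continuous (T : topologicalType) (v u : T -> I) :
  continuous v -> continuous u -> continuous (fun k => reel (v k) (u k)).
Proof.
move=> cv cu.
have cvv : continuous (fun k => val (v k) : R) by exact: continuous_val.
have cvu : continuous (fun k => val (u k) : R) by exact: continuous_val.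
by rewrite /reel; continuity.
Qed.

Lemma reel_zero v : reel v zero = 0.
Proof. by rewrite /reel val_zero !mulr0 oppr0 max_l //; lra. Qed.

Lemma reel_one v : reel v one = 1.
Proof. by rewrite /reel val_one max_r; have := I01_le1 v; lra. Qed.

Lemma reel_ge v u : -1 <= reel v u.
Proof.
have v0 := I01_ge0 v; have v1 := I01_le1 v.
have u0 := I01_ge0 u; have u1 := I01_le1 u.
rewrite /reel le_max; have [uh|uh] := leP (val u : R) (1 / 2).
  by apply/orP; left; nra.
by apply/orP; right; lra.
Qed.

Lemma reel_le v u : reel v u <= 1.
Proof.
have v1 := I01_le1 v; have u0 := I01_ge0 u; have u1 := I01_le1 u.
by rewrite /reel ge_max; apply/andP; split; nra.
Qed.

Section RunLoop.
Variables (K : topologicalType) (a : K -> Om R X) (c : K -> R) (d : K -> fpath R X).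
Hypotheses (chK : compact_hausdorff K)
  (ca : continuous a) (cc : continuous c) (cd : continuous d).
Hypothesis d1 : forall k, path_at (d k) one = point.

Lemma run_loop_family :
  (forall k, loop_at (a k) (clamp (c k)) = path_at (d k) zero) ->
  (forall k, is_loop (fun t : I => run (a k) (c k) (d k) (2 * val t - 1))) /\
  continuous (fun k => run_loop (a k) (c k) (d k)).
Proof.
move=> ad.
apply: (mk_loop_continuous (F := fun k t => run (a k) (c k) (d k) (2 * val t - 1))) => //.
- apply: (@run_continuous (K * I)%type (fun p => a p.1) (fun p => c p.1)
    (fun p => d p.1) (fun p => 2 * val p.2 - 1)) => //.
  + by continuity.
  + by continuity.
  + by continuity.
  + have cv : continuous (fun p : K * I => val p.2 : R) by apply: continuous_val; continuity.
    by continuity.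
- by move=> k; rewrite val_zero mulr0 sub0r run_start.
- move=> k; rewrite val_one mulr1.
  have -> : 2 - 1 = 1 :> R by ring.
  by rewrite run_end.
Qed.

Lemma reel_loop_family (v : K -> I) :
  continuous v -> (forall k, path_at (d k) zero = point) ->
  (forall k, is_loop (fun t : I => run (a k) 1 (d k) (reel (v k) t))) /\
  continuous (fun k => reel_loop (a k) (d k) (v k)).
Proof.
move=> cv d0.
apply: (mk_loop_continuous (F := fun k t => run (a k) 1 (d k) (reel (v k) t))) => //.
- apply: (@run_continuous (K * I)%type (fun p => a p.1) (fun p => 1)
    (fun p => d p.1) (fun p => reel (v p.1) p.2)) => //.
  + by continuity.
  + by continuity.
  + by continuity.
  + by apply: reel_continuous; continuity.
  + by move=> k; rewrite clamp1 loop_at1 d0.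
- by move=> k; rewrite reel_zero /run lexx addr0 mulr1 clamp1 loop_at1.
- by move=> k; rewrite reel_one run_end.
Qed.
End RunLoop.

(** From [[a, c]] back to the base point, then through the class of [run_loop].
    Both halves are lifts of parts of [run], so that the path lies over the one
    with the parameter [reel zero]; see [ev_lasso]. For [c = 1] it is a loop. *)
Definition lasso (a : Om R X) (c : R) (d : fpath R X) (u : I) : Y :=
  if val u <= 1 / 2 then sg (a, clamp (c * (1 - 2 * val u)))
  else sg (run_loop a c d, clamp (2 * val u - 1)).

Definition lasso_loop (a : Om R X) (d : fpath R X) : Om R Y :=
  mk_loop (lasso a 1 d).

Lemma lasso_continuous (K : topologicalType) (a : K -> Om R X) (c : K -> R)
    (d : K -> fpath R X) (u : K -> I) :
  compact_hausdorff K ->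
  continuous a -> continuous c -> continuous d -> continuous u ->
  (forall k, path_at (d k) one = point) ->
  (forall k, loop_at (a k) (clamp (c k)) = path_at (d k) zero) ->
  continuous (fun k => lasso (a k) (c k) (d k) (u k)).
Proof.
move=> chK ca cc cd cu d1 ad.
have cvu : continuous (fun k => val (u k) : R) by exact: continuous_val.
have [_ cl] := run_loop_family chK ca cc cd d1 ad.
have csg (Z : ptopologicalType) : continuous (@sg R Z) := @qpi_continuous _ _.
apply: (@if_le_continuous R _ _ (fun k => val (u k)) (fun _ => 1 / 2)
  (fun k => sg (a k, clamp (c k * (1 - 2 * val (u k)))))
  (fun k => sg (run_loop (a k) (c k) (d k), clamp (2 * val (u k) - 1)))) => //.
- exact: continuous_cst.
- apply: (continuous_compose (@set_val_continuous _ _)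
    (g := fun k => sg (a k, clamp (c k * (1 - 2 * val (u k)))))).
  by refine (continuous_compose _ (csg _)); continuity.
- apply: (continuous_compose (@set_val_continuous _ _)
    (g := fun k => sg (run_loop (a k) (c k) (d k), clamp (2 * val (u k) - 1)))).
  by refine (continuous_compose _ (csg _)); continuity.
- move=> k ->; have -> : 2 * (1 / 2) = 1 :> R by field.
  by rewrite subrr mulr0 clamp0 !sg_pt; auto.
Qed.

Lemma lasso_zero a c d : lasso a c d zero = sg (a, clamp c).
Proof. by rewrite /lasso val_zero ifT ?mulr0 ?subr0 ?mulr1 //; lra. Qed.

Lemma lasso_one a c d : lasso a c d one = point.
Proof.
rewrite /lasso val_one ifF; last by apply/negbTE; rewrite -ltNge; lra.
by rewrite clamp_ge1 ?sg_pt; [|auto|lra].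
Qed.

Lemma lasso_loop_family (K : topologicalType) (a : K -> Om R X) (d : K -> fpath R X) :
  compact_hausdorff K -> continuous a -> continuous d ->
  (forall k, path_at (d k) one = point) -> (forall k, path_at (d k) zero = point) ->
  (forall k, is_loop (lasso (a k) 1 (d k))) /\
  continuous (fun k => lasso_loop (a k) (d k)).
Proof.
move=> chK ca cd d1 d0.
apply: (mk_loop_continuous (F := fun k => lasso (a k) 1 (d k))) => //.
- apply: (@lasso_continuous (K * I)%type (fun p => a p.1) (fun p => 1)
    (fun p => d p.1) snd) => //.
  + exact: compact_hausdorff_prod (compact_hausdorff_I01 R).
  + by continuity.
  + by continuity.
  + by continuity.
  + by continuity.
  + by move=> p; rewrite clamp1 loop_at1 d0.
- by move=> k; rewrite lasso_zero clamp1 sg_pt; auto.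
- by move=> k; exact: lasso_one.
Qed.

Lemma lasso_loopE a d u : path_at d one = point -> path_at d zero = point ->
  loop_at (lasso_loop a d) u = lasso a 1 d u.
Proof.
move=> d1 d0.
have [h _] := @lasso_loop_family I (fun _ => a) (fun _ => d) (compact_hausdorff_I01 R)
  (@continuous_cst _ _ _) (@continuous_cst _ _ _) (fun _ => d1) (fun _ => d0).
exact: (loop_at_mk _ (h zero)).
Qed.

Lemma run_loopE a c d u : path_at d one = point ->
  loop_at a (clamp c) = path_at d zero ->
  loop_at (run_loop a c d) u = run a c d (2 * val u - 1).
Proof.
move=> d1 ad.
have [h _] := @run_loop_family I (fun _ => a) (fun _ => c) (fun _ => d)
  (compact_hausdorff_I01 R) (@continuous_cst _ _ _) (@continuous_cst _ _ _)
  (@continuous_cst _ _ _) (fun _ => d1) (fun _ => ad).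
exact: (loop_at_mk _ (h zero)).
Qed.

Lemma reel_loopE a d v u : path_at d one = point -> path_at d zero = point ->
  loop_at (reel_loop a d v) u = run a 1 d (reel v u).
Proof.
move=> d1 d0.
have [h _] := @reel_loop_family I (fun _ => a) (fun _ => d)
  (compact_hausdorff_I01 R) (@continuous_cst _ _ _) (@continuous_cst _ _ _)
  (fun _ => d1) (fun _ => v) (@continuous_cst _ _ _) (fun _ => d0).
exact: (loop_at_mk _ (h zero)).
Qed.

Lemma ev_lasso a c d u : path_at d one = point ->
  loop_at a (clamp c) = path_at d zero ->
  ev R X (lasso a c d u) = run a c d (reel zero u).
Proof.
move=> d1 ad; have u0 := I01_ge0 u; have u1 := I01_le1 u.
rewrite /lasso /reel val_zero; case: ifPn => uh.
  rewrite ev_sg max_l; last by lra.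
  rewrite /run ifT; last by lra.
  by congr (loop_at a (clamp (c * _))); ring.
move: uh; rewrite -ltNge => uh.
rewrite ev_sg run_loopE // max_r; last by lra.
by rewrite val_clamp; [|lra|lra]; congr run; ring.
Qed.

Lemma Om_map_lasso_loop a d : path_at d one = point -> path_at d zero = point ->
  Om_map R (ev R X) (lasso_loop a d) = reel_loop a d zero.
Proof.
move=> d1 d0; apply: loop_eqP => t.
rewrite reel_loopE // -ev_lasso ?clamp1 ?loop_at1 //.
by rewrite [LHS]/(ev R X (loop_at _ t)) lasso_loopE.
Qed.


(** ** The null-homotopy over the fibre *)

Lemma run_pt c d r : run (point : Om R X) c d r = run point 1 d r.
Proof. by []. Qed.

Lemma run_c0 a d r : run a 0 d r = run point 1 d r.
Proof. by rewrite /run mul0r clamp0 loop_at0. Qed.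

Lemma run_ge0 a d r : 0 <= r -> run a 1 d r = run point 1 d r.
Proof.
move=> r0; rewrite /run; case: ifPn => // r0'.
have -> : r = 0 by apply/le_anti/andP.
by rewrite addr0 mulr1 clamp1 !loop_at1.
Qed.

Lemma run_pt_max d r r' : Num.max 0 r = Num.max 0 r' ->
  run (point : Om R X) 1 d r = run point 1 d r'.
Proof.
have rE x : run (point : Om R X) 1 d x = run point 1 d (Num.max 0 x).
  by rewrite /run; case: (leP x 0) => [x0|x0]; rewrite ?lexx // leNgt x0.
by move=> rr; rewrite rE rr -rE.
Qed.

Lemma reel_max v u : Num.max 0 (reel v u) = Num.max 0 (4 * val u - 3).
Proof.
have v1 := I01_le1 v; have u0 := I01_ge0 u.
by rewrite /reel maxA [Num.max 0 (- _)]max_l //; nra.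
Qed.

Lemma reel_one_ge0 u : 0 <= reel one u.
Proof. by rewrite /reel val_one subrr mulr0 mul0r oppr0 le_max lexx. Qed.

Lemma run_reel_one a d v u : run a 1 d (reel one u) = run point 1 d (reel v u).
Proof. by rewrite run_ge0 ?reel_one_ge0 //; apply: run_pt_max; rewrite !reel_max. Qed.

Lemma reel_loop_one a d v : path_at d one = point -> path_at d zero = point ->
  reel_loop a d one = reel_loop point d v.
Proof.
by move=> d1 d0; apply: loop_eqP => t; rewrite !reel_loopE // (run_reel_one a d v).
Qed.

Lemma reel_loop_pt d v w : path_at d one = point -> path_at d zero = point ->
  reel_loop point d v = reel_loop point d w.
Proof. by move=> d1 d0; rewrite -!(@reel_loop_one point). Qed.

Lemma lasso_pt c d u : lasso point c d u = lasso point 1 d u.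
Proof. by rewrite /lasso !(@sg_pt R (Om R X) point) //; left. Qed.

Lemma lasso_c0 a d u : lasso a 0 d u = lasso point 1 d u.
Proof.
rewrite /lasso mul0r clamp0; case: ifP => _; first by rewrite !sg_pt; auto.
have -> // : run_loop a 0 d = run_loop point 1 d.
by congr mk_loop; apply/funext => t; exact: run_c0.
Qed.

Lemma run_cst d r : (forall t, path_at d t = point) -> run point 1 d r = point.
Proof. by move=> dp; rewrite /run dp; case: ifP. Qed.

Lemma lasso_cst d u : (forall t, path_at d t = point) -> lasso point 1 d u = point.
Proof.
move=> dp; rewrite /lasso; case: ifP => _; first by apply: sg_pt; left.
apply: sg_pt; left; apply: loop_eqP => t.
by rewrite run_loopE ?run_cst ?clamp1 ?loop_at1.
Qed.

Notation J := (@vertex_incl R X).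

(** The null-homotopy over the point of the fibre given by the loop [a], the time
    [4 * s] on it, cut off at [1], and the path [d]; its parameter is [u]. In the
    quarters of the interval for [s],
    - the segment of [a] grows from nothing to the whole loop;
    - the cell attached to [lasso_loop] is crossed, from its end in [SO X] given by
      the loop itself to the one given by the image of the loop in [X];
    - the detour along [a] in this image is cancelled;
    - the cell attached to [lasso_loop] for the constant loop is crossed in the
      opposite direction, which leads back to the path for [s = 0].
    The number [l] is [1 / 2] or less only if [a] is constant. Then the first and the
    third quarter are constant, the others are inverse to each other, and for
    small [l] only a part of the cell is crossed and none for [l = 0]. *)
Definition late_contraction (a : Om R X) (d : fpath R X) (s u : I) : M :=
  if val s <= 3 / 4 then J (sg (reel_loop a d (clamp (4 * val s - 2)), u))
  else cell (lasso_loop point d) u (clamp (4 * val s - 3)).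

Definition mid_contraction (a : Om R X) (d : fpath R X) (s u : I) : M :=
  if val s <= 1 / 2 then cell (lasso_loop a d) u (clamp (2 - 4 * val s))
  else late_contraction a d s u.

Definition full_contraction (a : Om R X) (d : fpath R X) (s u : I) : M :=
  if val s <= 1 / 4 then J (lasso a (4 * val s) d u)
  else mid_contraction a d s u.

Definition contraction (l : R) (a : Om R X) (d : fpath R X) (s u : I) : M :=
  if l <= 1 / 2 then
    cell (lasso_loop point d) u
      (clamp (1 - Num.min (2 * l) (Num.min (4 * val s - 1) (4 - 4 * val s))))
  else full_contraction a d s u.

Lemma cell_lasso_zero a d u : path_at d one = point -> path_at d zero = point ->
  cell (lasso_loop a d) u zero = J (sg (reel_loop a d zero, u)).
Proof. by move=> d1 d0; rewrite cell_zero Om_map_lasso_loop. Qed.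

Lemma cell_lasso_one a d u : path_at d one = point -> path_at d zero = point ->
  cell (lasso_loop a d) u one = J (lasso a 1 d u).
Proof. by move=> d1 d0; rewrite cell_one lasso_loopE. Qed.

Section ContractionContinuity.
Variables (K : topologicalType) (a : K -> Om R X) (d : K -> fpath R X) (s u : K -> I).
Hypotheses (chK : compact_hausdorff K)
  (ca : continuous a) (cd : continuous d) (cs : continuous s) (cu : continuous u).
Hypothesis d1 : forall k, path_at (d k) one = point.

Let cvs : continuous (fun k => val (s k) : R).
Proof. exact: continuous_val. Qed.

Lemma late_contraction_continuous :
  (forall k, path_at (d k) zero = point) ->
  continuous (fun k => late_contraction (a k) (d k) (s k) (u k)).
Proof.
move=> d0.
apply: (@if_le_continuous R _ _ (fun k => val (s k)) (fun _ => 3 / 4)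
  (fun k => J (sg (reel_loop (a k) (d k) (clamp (4 * val (s k) - 2)), u k)))
  (fun k => cell (lasso_loop point (d k)) (u k) (clamp (4 * val (s k) - 3)))) => //.
- exact: continuous_cst.
- apply: (continuous_compose (@set_val_continuous _ _)
    (g := fun k => J (sg (reel_loop (a k) (d k) (clamp (4 * val (s k) - 2)), u k)))).
  refine (continuous_compose _ (pfun_cts _)).
  refine (continuous_compose _ (@qpi_continuous _ _)).
  apply: pair_continuous => //; apply: (reel_loop_family _ _ _ _ _ _).2 => //.
  by continuity.
- apply: (continuous_compose (@set_val_continuous _ _)
    (g := fun k => cell (lasso_loop point (d k)) (u k) (clamp (4 * val (s k) - 3)))).
  apply: cell_continuous => //; last by continuity.
  by apply: (lasso_loop_family _ _ _ _ _).2 => //; exact: continuous_cst.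
- move=> k ->; have -> : 4 * (3 / 4) - 2 = 1 :> R by field.
  have -> : 4 * (3 / 4) - 3 = 0 :> R by field.
  by rewrite clamp1 clamp0 cell_lasso_zero // (reel_loop_one _ zero).
Qed.

Lemma mid_contraction_continuous :
  (forall k, path_at (d k) zero = point) ->
  continuous (fun k => mid_contraction (a k) (d k) (s k) (u k)).
Proof.
move=> d0.
apply: (@if_le_continuous R _ _ (fun k => val (s k)) (fun _ => 1 / 2)
  (fun k => cell (lasso_loop (a k) (d k)) (u k) (clamp (2 - 4 * val (s k))))
  (fun k => late_contraction (a k) (d k) (s k) (u k))) => //.
- exact: continuous_cst.
- apply: (continuous_compose (@set_val_continuous _ _)
    (g := fun k => cell (lasso_loop (a k) (d k)) (u k) (clamp (2 - 4 * val (s k))))).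
  apply: cell_continuous => //; last by continuity.
  by apply: (lasso_loop_family _ _ _ _ _).2.
- exact: (continuous_compose (@set_val_continuous _ _) (late_contraction_continuous d0)).
- move=> k sk; rewrite /late_contraction sk ifT; last by lra.
  have -> : 4 * (1 / 2) - 2 = 0 :> R by field.
  have -> : 2 - 4 * (1 / 2) = 0 :> R by field.
  by rewrite clamp0 cell_lasso_zero.
Qed.
End ContractionContinuity.

(** Beyond the first quarter the path starts at the end of the loop, hence is a
    loop. *)
Lemma quarter_end (a : Om R X) (d : fpath R X) (s : I) : 1 / 4 <= val s :> R ->
  loop_at a (clamp (4 * val s)) = path_at d zero -> path_at d zero = point.
Proof. by move=> s4 <-; rewrite clamp_ge1 ?loop_at1 //; lra. Qed.

Lemma full_contraction_continuous (K : topologicalType) (a : K -> Om R X)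
    (d : K -> fpath R X) (s u : K -> I) :
  compact_hausdorff K ->
  continuous a -> continuous d -> continuous s -> continuous u ->
  (forall k, path_at (d k) one = point) ->
  (forall k, loop_at (a k) (clamp (4 * val (s k))) = path_at (d k) zero) ->
  continuous (fun k => full_contraction (a k) (d k) (s k) (u k)).
Proof.
move=> chK ca cd cs cu d1 ad.
have cvs : continuous (fun k => val (s k) : R) by exact: continuous_val.
have c1 : continuous (fun _ : K => 1 / 4 : R) := @continuous_cst _ _ _.
have cvl := closed_le_fun c1 cvs.
have cv (A : set K) := @set_val_continuous _ A.
apply: (@if_le_continuous R _ _ (fun k => val (s k)) (fun _ => 1 / 4)
  (fun k => J (lasso (a k) (4 * val (s k)) (d k) (u k)))
  (fun k => mid_contraction (a k) (d k) (s k) (u k))) => //.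
- apply: (continuous_compose (@set_val_continuous _ _)
    (g := fun k => J (lasso (a k) (4 * val (s k)) (d k) (u k)))).
  refine (continuous_compose _ (pfun_cts _)).
  by apply: lasso_continuous => //; continuity.
- apply: (@mid_contraction_continuous (set_type _) (fun k => a (val k))
    (fun k => d (val k)) (fun k => s (val k)) (fun k => u (val k))).
  + exact: compact_hausdorff_set_type.
  + exact: (continuous_compose (@cv _) ca).
  + exact: (continuous_compose (@cv _) cd).
  + exact: (continuous_compose (@cv _) cs).
  + exact: (continuous_compose (@cv _) cu).
  + by move=> k; exact: d1.
  + by move=> k; apply: quarter_end (ad _); exact: (set_mem (valP k)).
- move=> k sk; rewrite /mid_contraction sk ifT; last by lra.
  have d0 : path_at (d k) zero = point by apply: quarter_end (ad k); rewrite sk.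
  have -> : 4 * (1 / 4) = 1 :> R by field.
  have -> : 2 - 1 = 1 :> R by ring.
  by rewrite clamp1 cell_lasso_one.
Qed.

Lemma full_contraction_pt d (s u : I) :
  path_at d one = point -> path_at d zero = point ->
  full_contraction point d s u =
  cell (lasso_loop point d) u
    (clamp (1 - Num.min 1 (Num.min (4 * val s - 1) (4 - 4 * val s)))).
Proof.
move=> d1 d0; have s0 := I01_ge0 s; have s1 := I01_le1 s.
rewrite /full_contraction /mid_contraction /late_contraction.
case: ifPn => [s4|]; last rewrite -ltNge => s4.
  rewrite lasso_pt clamp_ge1 ?cell_lasso_one //.
  by rewrite [Num.min _ (4 - _)]min_l ?min_r; lra.
case: ifPn => [s2|]; last rewrite -ltNge => s2.
  congr (cell _ _ (clamp _)).
  by rewrite [Num.min _ (4 - _)]min_l ?min_r; lra.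
case: ifPn => [s3|]; last rewrite -ltNge => s3.
  rewrite [Num.min 1 _]min_l ?subrr ?clamp0; last by rewrite le_min; apply/andP; split; lra.
  by rewrite cell_lasso_zero // (reel_loop_pt _ zero).
congr (cell _ _ (clamp _)).
by rewrite [Num.min _ (4 - _)]min_r ?min_r; lra.
Qed.

Lemma contraction_continuous (K : topologicalType) (l : K -> R) (a : K -> Om R X)
    (d : K -> fpath R X) (s u : K -> I) :
  compact_hausdorff K -> continuous l ->
  continuous a -> continuous d -> continuous s -> continuous u ->
  (forall k, l k < 1 -> a k = point) ->
  (forall k, path_at (d k) one = point) ->
  (forall k, loop_at (a k) (clamp (4 * val (s k))) = path_at (d k) zero) ->
  continuous (fun k => contraction (l k) (a k) (d k) (s k) (u k)).
Proof.
move=> chK cl ca cd cs cu la d1 ad.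
have cvs : continuous (fun k => val (s k) : R) by exact: continuous_val.
have c1 : continuous (fun _ : K => 1 / 2 : R) := @continuous_cst _ _ _.
have cvl := closed_le_fun cl c1.
have cv (A : set K) := @set_val_continuous _ A.
have d0 k : l k <= 1 / 2 -> path_at (d k) zero = point.
  by move=> lk; rewrite -ad la //; lra.
apply: (@if_le_continuous R _ _ l (fun _ => 1 / 2)
  (fun k => cell (lasso_loop point (d k)) (u k)
    (clamp (1 - Num.min (2 * l k) (Num.min (4 * val (s k) - 1) (4 - 4 * val (s k))))))
  (fun k => full_contraction (a k) (d k) (s k) (u k))) => //.
- apply: cell_continuous.
  + apply: (@lasso_loop_family (set_type _) (fun _ => point) (fun k => d (val k)) _ _ _ _ _).2.
    * exact: compact_hausdorff_set_type.
    * exact: continuous_cst.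
    * exact: (continuous_compose (@cv _) cd).
    * by move=> k; exact: d1.
    * by move=> k; apply: d0; exact: (set_mem (valP k)).
  + exact: (continuous_compose (@cv _) cu).
  + apply: (continuous_compose (@cv _) (g := fun k => clamp (1 - Num.min (2 * l k)
      (Num.min (4 * val (s k) - 1) (4 - 4 * val (s k)))))).
    by continuity.
- apply: (continuous_compose (@cv _)
    (g := fun k => full_contraction (a k) (d k) (s k) (u k))).
  exact: full_contraction_continuous.
- move=> k lk; have d0k : path_at (d k) zero = point by apply: d0; rewrite lk.
  rewrite la ?lk ?full_contraction_pt //; last by lra.
  by have -> : 2 * (1 / 2) = 1 :> R by field.
Qed.

Lemma contraction_one l a d s : contraction l a d s one = point.
Proof.
rewrite /contraction /full_contraction /mid_contraction /late_contraction.
by do 4?case: ifP => _; rewrite ?cell_pt ?lasso_one ?sg_pt ?pfun_pt; auto.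
Qed.

Lemma contraction_zero l a d s :
  (l < 1 -> a = point) -> contraction l a d s zero = J (sg (a, clamp (4 * val s))).
Proof.
move=> la; rewrite /contraction; case: ifPn => [l2|_].
  by rewrite la ?cell_pt ?sg_pt ?pfun_pt; auto; lra.
rewrite /full_contraction; case: ifPn => [_|]; first by rewrite lasso_zero.
rewrite -ltNge => s4; rewrite [clamp (4 * _)]clamp_ge1; last by lra.
rewrite [sg (a, _)]sg_pt ?pfun_pt; auto.
rewrite /mid_contraction /late_contraction.
by do 2?case: ifP => _; rewrite ?cell_pt ?sg_pt ?pfun_pt; auto.
Qed.

Lemma contraction_flat l a d s u : 0 <= l ->
  path_at d one = point -> path_at d zero = point ->
  (a = point /\ l = 0) \/ s = zero \/ s = one ->
  contraction l a d s u = J (lasso point 1 d u).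
Proof.
move=> l0 d1 d0; rewrite -cell_lasso_one // => h.
have s0 := I01_ge0 s; have s1 := I01_le1 s.
rewrite /contraction; case: ifPn => [l2|]; last rewrite -ltNge => l2.
  congr cell; apply: clamp_ge1.
  have : Num.min (2 * l) (Num.min (4 * val s - 1) (4 - 4 * val s)) <= 0.
    rewrite !ge_min; case: h => [[_ ->]|[->|->]].
    - by rewrite mulr0 lexx.
    - by rewrite val_zero; apply/orP; right; apply/orP; left; lra.
    - by rewrite val_one; apply/orP; right; apply/orP; right; lra.
  lra.
case: h => [[_ l00]|[sE|sE]]; first by exfalso; lra.
  rewrite /full_contraction sE val_zero mulr0 ifT; last by lra.
  by rewrite lasso_c0 cell_lasso_one.
rewrite /full_contraction /mid_contraction /late_contraction sE val_one.
rewrite !ifF; [|apply/negbTE; rewrite -ltNge; lra..].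
by rewrite clamp_ge1 //; lra.
Qed.

Lemma realization_map_contraction l a d s u :
  (l < 1 -> a = point) -> path_at d one = point ->
  loop_at a (clamp (4 * val s)) = path_at d zero ->
  realization_map R (Lambda R X) 1 (contraction l a d s u) =
  run a (val (clamp (4 * val s))) d (reel (clamp (4 * val s - 2)) u).
Proof.
move=> la d1 ad; have s0 := I01_ge0 s; have s1 := I01_le1 s.
have lassoE b : path_at d zero = point ->
    ev R X (loop_at (lasso_loop b d) u) = run b 1 d (reel zero u).
  by move=> d0; rewrite lasso_loopE // ev_lasso ?clamp1 ?loop_at1.
rewrite /contraction; case: ifPn => [l2|_].
  have aE : a = point by apply: la; lra.
  rewrite realization_map_cell lassoE; last by rewrite -ad aE.
  by rewrite aE [RHS]run_pt; apply: run_pt_max; rewrite !reel_max.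
rewrite /full_contraction; case: ifPn => [s4|].
  rewrite realization_map_vertex ev_lasso // [clamp (_ - 2)]clamp_le0; last by lra.
  by rewrite val_clamp //; lra.
rewrite -ltNge => s4; have d0 : path_at d zero = point by apply: quarter_end ad; lra.
rewrite [clamp (4 * val s)]clamp_ge1 ?val_one; last by lra.
rewrite /mid_contraction; case: ifPn => [s2|].
  by rewrite realization_map_cell lassoE // clamp_le0 //; lra.
rewrite -ltNge => s2; rewrite /late_contraction; case: ifPn => [s3|].
  by rewrite realization_map_vertex ev_sg reel_loopE.
rewrite -ltNge => s3; rewrite realization_map_cell lassoE // clamp_ge1; last by lra.
by rewrite (run_reel_one a d zero).
Qed.

(** The homotopy from the image of [contraction] in [X] to the constant path. It
    raises all parameters of [run] to [1]. The maximum, rather than an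
    interpolation, makes the positive part of the parameter independent of the
    negative part, as needed for [advance_flat]: where nothing remains of the loop
    [a], the negative parameters are not seen. *)
Definition advance (a : Om R X) (d : fpath R X) (s u t : I) : X :=
  run a (val (clamp (4 * val s))) d
    (Num.max (reel (clamp (4 * val s - 2)) u) (2 * val t - 1)).

Lemma advance_continuous (T : topologicalType) (a : T -> Om R X)
    (d : T -> fpath R X) (s u t : T -> I) :
  continuous a -> continuous d -> continuous s -> continuous u -> continuous t ->
  (forall k, loop_at (a k) (clamp (4 * val (s k))) = path_at (d k) zero) ->
  continuous (fun k => advance (a k) (d k) (s k) (u k) (t k)).
Proof.
move=> ca cd cs cu ct ad.
have cvs : continuous (fun k => val (s k) : R) by exact: continuous_val.
have cvt : continuous (fun k => val (t k) : R) by exact: continuous_val.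
apply: run_continuous => //.
- by apply: continuous_val; continuity.
- apply: continuous_maxr; last by continuity.
  by apply: reel_continuous => //; continuity.
- by move=> k; rewrite clamp_val.
Qed.

Lemma advance_t0 a d s u :
  advance a d s u zero =
  run a (val (clamp (4 * val s))) d (reel (clamp (4 * val s - 2)) u).
Proof.
by rewrite /advance max_l // val_zero mulr0 sub0r reel_ge.
Qed.

Lemma advance_t1 a d s u : path_at d one = point -> advance a d s u one = point.
Proof.
move=> d1; rewrite /advance val_one max_r ?mulr1.
  have -> : 2 - 1 = 1 :> R by ring.
  exact: run_end.
have := reel_le (clamp (4 * val s - 2)) u; lra.
Qed.

Lemma advance_u1 a d s t : path_at d one = point -> advance a d s one t = point.
Proof.
move=> d1; rewrite /advance reel_one max_l ?run_end //.
have := I01_le1 t; lra.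
Qed.

Lemma advance_u0 a d s t : loop_at a (clamp (4 * val s)) = path_at d zero ->
  advance a d s zero t = path_at d (clamp (2 * val t - 1)).
Proof.
move=> ad; rewrite /advance reel_zero /run; case: ifPn => t0.
  have t0' : 2 * val t - 1 <= 0 by apply: le_trans t0; rewrite le_max lexx orbT.
  rewrite max_l // addr0 mulr1 clamp_val ad clamp_le0 //.
by move: t0; rewrite ge_max lexx /= -ltNge => t0; rewrite max_r // ltW.
Qed.

Lemma advance_flat a d s u t :
  a = point \/ s = zero \/ s = one ->
  advance a d s u t = run point 1 d (Num.max (4 * val u - 3) (2 * val t - 1)).
Proof.
have maxE v : run (point : Om R X) 1 d (Num.max (reel v u) (2 * val t - 1)) =
    run point 1 d (Num.max (4 * val u - 3) (2 * val t - 1)).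
  by apply: run_pt_max; rewrite [LHS]maxA [RHS]maxA reel_max.
rewrite /advance; case=> [->|[->|->]]; first exact: maxE.
  by rewrite val_zero mulr0 clamp0 val_zero run_c0 maxE.
rewrite val_one mulr1 [clamp 4]clamp_ge1 ?[clamp (4 - 2)]clamp_ge1; [|lra..].
by rewrite val_one run_ge0 ?maxE // le_max reel_one_ge0.
Qed.


(** ** The map from the second Ganea space *)

Section Assembly.
Variables (u : X -> R) (h : X * I -> X).
Hypotheses (cu : continuous u) (ch : continuous h) (u01 : forall x, 0 <= u x <= 1).
Hypotheses (u_pt : u point = 0) (h0 : forall x, h (x, zero) = x).
Hypotheses (h_pt : forall t, h (point, t) = point).
Hypothesis h1 : forall x, u x < 1 -> h (x, one) = point.
Hypothesis wX : weak_hausdorff X.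

Lemma end_map_continuous : continuous (fun x => h (x, one)).
Proof.
have ci : continuous (fun x : X => (x, one : I)) by continuity.
exact: (continuous_compose ci ch).
Qed.

Definition end_map : ptmap X X := PtMap end_map_continuous (h_pt one).

Lemma end_map_loop a : loop_sup u a < 1 -> Om_map R end_map a = point.
Proof.
move=> ua; apply: loop_eqP => t; rewrite Om_mapE; apply: h1.
exact: le_lt_trans (le_loop_sup u01 a t) ua.
Qed.

(** The point [[a, s]] of [SO X] is to be replaced by [[end_map a, 4 * s]]. This
    path joins the images of the two in [X], by [pull_path0] and [pull_path1]. *)
Definition pull (a : Om R X) (s w : I) : X :=
  h (loop_at a (clamp ((4 - 3 * val w) * val s)), clamp (1 - val w)).

Lemma pull_continuous (T : topologicalType) (a : T -> Om R X) (s w : T -> I) :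
  continuous a -> continuous s -> continuous w ->
  continuous (fun k => pull (a k) (s k) (w k)).
Proof.
move=> ca cs cw.
have cvs : continuous (fun k => val (s k) : R) by exact: continuous_val.
have cvw : continuous (fun k => val (w k) : R) by exact: continuous_val.
rewrite /pull; refine (continuous_compose _ ch).
by continuity.
Qed.

Lemma pull_pt a s w : a = point \/ s = zero \/ s = one -> pull a s w = point.
Proof.
move=> hs; rewrite /pull; have -> : loop_at a (clamp ((4 - 3 * val w) * val s)) = point.
  case: hs => [->|[->|->]] //; first by rewrite val_zero mulr0 clamp0 loop_at0.
  by rewrite val_one mulr1 clamp_ge1 ?loop_at1 //; have := I01_le1 w; lra.
exact: h_pt.
Qed.

Lemma pull_path_compat (p q : Om R X * I) :
  (p.1 = point \/ p.2 = zero \/ p.2 = one) /\ (q.1 = point \/ q.2 = zero \/ q.2 = one) ->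
  mk_fpath (pull p.1 p.2) = mk_fpath (pull q.1 q.2).
Proof.
by move=> [hp hq]; congr mk_fpath; apply/funext => w; rewrite !pull_pt.
Qed.

Lemma pull_path_continuous : continuous (fun p : Om R X * I => mk_fpath (pull p.1 p.2)).
Proof. by apply: mk_fpath_continuous; apply: pull_continuous; continuity. Qed.

Lemma pull_path_pt : mk_fpath (pull (point : Om R X * I).1 (point : Om R X * I).2) = point.
Proof.
apply: fpath_eqP => w; rewrite path_at_mk ?pull_pt //; first by left.
by apply: pull_continuous; continuity.
Qed.

Definition pull_path : ptmap Y (fpath R X) :=
  qmap pull_path_compat pull_path_continuous pull_path_pt.

Lemma pull_pathE a s w : path_at (pull_path (sg (a, s))) w = pull a s w.
Proof.
rewrite [pull_path _](qliftE pull_path_compat) path_at_mk //.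
by apply: pull_continuous; continuity.
Qed.

Lemma pull_path1 y : path_at (pull_path y) one = ev R X y.
Proof.
move: y; apply: Sg_ind => a s; rewrite pull_pathE ev_sg /pull val_one subrr clamp0 h0.
have -> : (4 - 3 * 1) * val s = val s :> R by ring.
by rewrite clamp_val.
Qed.

Lemma squeeze_pt (p : Om R X * I) : p.1 = point \/ p.2 = zero \/ p.2 = one ->
  (sg (Om_map R end_map p.1, clamp (4 * val p.2)) : Y) = point.
Proof.
case=> [->|[->|->]]; first by rewrite pfun_pt sg_pt; auto.
  by rewrite val_zero mulr0 clamp0 sg_pt; auto.
by rewrite val_one mulr1 clamp_ge1 ?sg_pt; auto; lra.
Qed.

Lemma squeeze_compat (p q : Om R X * I) :
  (p.1 = point \/ p.2 = zero \/ p.2 = one) /\ (q.1 = point \/ q.2 = zero \/ q.2 = one) ->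
  (sg (Om_map R end_map p.1, clamp (4 * val p.2)) : Y) =
  sg (Om_map R end_map q.1, clamp (4 * val q.2)).
Proof. by move=> [/squeeze_pt -> /squeeze_pt ->]. Qed.

Lemma squeeze_continuous :
  continuous (fun p : Om R X * I => sg (Om_map R end_map p.1, clamp (4 * val p.2)) : Y).
Proof.
have cvs : continuous (fun p : Om R X * I => val p.2 : R).
  by apply: continuous_val; continuity.
refine (continuous_compose _ (@qpi_continuous _ _)).
apply: pair_continuous; last by continuity.
by refine (continuous_compose _ (pfun_cts (Om_map R end_map))); continuity.
Qed.

Definition squeeze : ptmap Y Y :=
  qmap squeeze_compat squeeze_continuous (@squeeze_pt point (or_introl erefl)).

Lemma squeezeE a s : squeeze (sg (a, s)) = sg (Om_map R end_map a, clamp (4 * val s)).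
Proof. exact: (qliftE squeeze_compat). Qed.

Lemma pull_path0 y : path_at (pull_path y) zero = ev R X (squeeze y).
Proof.
move: y; apply: Sg_ind => a s; rewrite pull_pathE squeezeE ev_sg Om_mapE /pull.
by rewrite val_zero mulr0 !subr0 clamp1.
Qed.

Definition approach (y : Y) (c : fpath R X) : fpath R X := cat_path (pull_path y) c.

Lemma approach0 y c : ev R X y = path_at c zero ->
  path_at (approach y c) zero = ev R X (squeeze y).
Proof. by move=> yc; rewrite cat_path0 ?pull_path0 // pull_path1. Qed.

Lemma approach1 y c : ev R X y = path_at c zero ->
  path_at (approach y c) one = path_at c one.
Proof. by move=> yc; rewrite cat_path1 // pull_path1. Qed.

Lemma approach_continuous (T : topologicalType) (y : T -> Y) (c : T -> fpath R X) :
  continuous y -> continuous c -> (forall k, ev R X (y k) = path_at (c k) zero) ->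
  continuous (fun k => approach (y k) (c k)).
Proof.
move=> cy cc yc; apply: cat_path_continuous => //.
  by continuity.
by move=> k; rewrite pull_path1.
Qed.

Definition fiber_contraction (a : Om R X) (s : I) (c : fpath R X) : fpath R M :=
  mk_fpath (contraction (loop_sup u a) (Om_map R end_map a) (approach (sg (a, s)) c) s).

Definition fiber_advance (a : Om R X) (s : I) (c : fpath R X) : fpath R (fpath R X) :=
  mk_fpath (fun v => mk_fpath
    (advance (Om_map R end_map a) (approach (sg (a, s)) c) s v)).

Section Families.
Variables (K : topologicalType) (a : K -> Om R X) (s : K -> I) (c : K -> fpath R X).
Hypotheses (chK : compact_hausdorff K)
  (ca : continuous a) (cs : continuous s) (cc : continuous c).
Hypothesis ac : forall k, loop_at (a k) (s k) = path_at (c k) zero.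
Hypothesis c1 : forall k, path_at (c k) one = point.

Let csg : continuous (fun k => sg (a k, s k) : Y).
Proof. exact: (continuous_compose (pair_continuous ca cs) (@qpi_continuous _ _)). Qed.

Let match0 k : ev R X (sg (a k, s k)) = path_at (c k) zero.
Proof. by rewrite ev_sg. Qed.

Lemma approach_end k : path_at (approach (sg (a k, s k)) (c k)) one = point.
Proof. by rewrite approach1. Qed.

Lemma approach_start k :
  loop_at (Om_map R end_map (a k)) (clamp (4 * val (s k))) =
  path_at (approach (sg (a k, s k)) (c k)) zero.
Proof. by rewrite approach0 // squeezeE ev_sg. Qed.

Let cend : continuous (fun k => Om_map R end_map (a k)).
Proof. exact: (continuous_compose ca (pfun_cts (Om_map R end_map))). Qed.

Let capp : continuous (fun k => approach (sg (a k, s k)) (c k)).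
Proof. exact: approach_continuous. Qed.

Lemma fiber_contraction_continuous :
  continuous (fun k => fiber_contraction (a k) (s k) (c k)) /\
  forall k v, path_at (fiber_contraction (a k) (s k) (c k)) v =
    contraction (loop_sup u (a k)) (Om_map R end_map (a k))
      (approach (sg (a k, s k)) (c k)) (s k) v.
Proof.
pose F k v := contraction (loop_sup u (a k)) (Om_map R end_map (a k))
  (approach (sg (a k, s k)) (c k)) (s k) v.
have cF : continuous (fun p : K * I => F p.1 p.2).
  have cfst : continuous (fun p : K * I => p.1) by continuity.
  apply: contraction_continuous.
  - exact: compact_hausdorff_prod (compact_hausdorff_I01 R).
  - by apply: loop_sup_continuous => //; continuity.
  - exact: (continuous_compose cfst cend).
  - exact: (continuous_compose cfst capp).
  - by continuity.
  - by continuity.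
  - by move=> p; exact: end_map_loop.
  - by move=> p; exact: approach_end.
  - by move=> p; exact: approach_start.
split; first exact: (mk_fpath_continuous (F := F)).
by move=> k v; apply: path_at_mk; exact: (curry_continuous (F := F) cF).2.
Qed.

Lemma fiber_advance_continuous :
  continuous (fun k => fiber_advance (a k) (s k) (c k)) /\
  forall k v t, path_at (path_at (fiber_advance (a k) (s k) (c k)) v) t =
    advance (Om_map R end_map (a k)) (approach (sg (a k, s k)) (c k)) (s k) v t.
Proof.
pose F (p : K * I) (t : I) := advance (Om_map R end_map (a p.1))
  (approach (sg (a p.1, s p.1)) (c p.1)) (s p.1) p.2 t.
have cF : continuous (fun q : (K * I) * I => F q.1 q.2).
  have cfst : continuous (fun p : (K * I) * I => p.1.1) by continuity.
  apply: advance_continuous.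
  - exact: (continuous_compose cfst cend).
  - exact: (continuous_compose cfst capp).
  - by continuity.
  - by continuity.
  - by continuity.
  - by move=> p; exact: approach_start.
have cmF : continuous (fun p => mk_fpath (F p)) by exact: mk_fpath_continuous.
split; first exact: (mk_fpath_continuous (F := fun k v => mk_fpath (F (k, v)))).
move=> k v t.
have mkE := path_at_mk v ((curry_continuous (F := fun k v => mk_fpath (F (k, v))) cmF).2 k).
rewrite /fiber_advance -[fun v => mk_fpath _]/(fun v => mk_fpath (F (k, v))) mkE.
exact: (path_at_mk (f := F (k, v)) t ((curry_continuous (F := F) cF).2 (k, v))).
Qed.
End Families.

Lemma fiber_contractionE a s c v :
  loop_at a s = path_at c zero -> path_at c one = point ->
  path_at (fiber_contraction a s c) v =
  contraction (loop_sup u a) (Om_map R end_map a) (approach (sg (a, s)) c) s v.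
Proof.
move=> ac c1; exact: (fiber_contraction_continuous (K := I)
  (a := fun _ => a) (s := fun _ => s) (c := fun _ => c) (compact_hausdorff_I01 R)
  (@continuous_cst _ _ _) (@continuous_cst _ _ _) (@continuous_cst _ _ _)
  (fun _ => ac) (fun _ => c1)).2 zero v.
Qed.

Lemma fiber_advanceE a s c v t :
  loop_at a s = path_at c zero -> path_at c one = point ->
  path_at (path_at (fiber_advance a s c) v) t =
  advance (Om_map R end_map a) (approach (sg (a, s)) c) s v t.
Proof.
move=> ac c1; exact: (fiber_advance_continuous (K := I)
  (a := fun _ => a) (s := fun _ => s) (c := fun _ => c)
  (@continuous_cst _ _ _) (@continuous_cst _ _ _) (@continuous_cst _ _ _)
  (fun _ => ac)).2 zero v t.
Qed.

Let collapsed (a : Om R X) (s : I) := a = point \/ s = zero \/ s = one.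

Let collapsed_end a s : collapsed a s ->
  (Om_map R end_map a = point /\ loop_sup u a = 0) \/ s = zero \/ s = one.
Proof.
by case=> [->|]; [left; rewrite pfun_pt loop_sup_pt|right].
Qed.

Let collapsed_loop a s : collapsed a s -> loop_at a s = point.
Proof. by case=> [->|[->|->]]; rewrite ?loop_at0 ?loop_at1. Qed.

Let loop_sup_ge0 a : 0 <= loop_sup u a.
Proof.
have /andP[x0 _] := u01 (loop_at a zero).
exact: le_trans x0 (le_loop_sup u01 a zero).
Qed.

Lemma fiber_contraction_collapsed a s a' s' c :
  collapsed a s -> collapsed a' s' ->
  path_at c zero = point -> path_at c one = point ->
  fiber_contraction a s c = fiber_contraction a' s' c.
Proof.
have E b r : collapsed b r -> path_at c zero = point -> path_at c one = point ->
    forall v, path_at (fiber_contraction b r c) v = J (lasso point 1 (approach point c) v).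
  move=> br c0 c1 v; have bs : sg (b, r) = point :> Y by exact: sg_pt.
  rewrite fiber_contractionE ?c0 ?collapsed_loop // bs.
  have pc : ev R X point = path_at c zero by rewrite pfun_pt.
  apply: contraction_flat => //; last exact: collapsed_end.
    by rewrite approach1.
  by rewrite approach0 // !pfun_pt.
by move=> h1' h2 c0 c1; apply: fpath_eqP => v; rewrite !E.
Qed.

Lemma fiber_advance_collapsed a s a' s' c :
  collapsed a s -> collapsed a' s' ->
  path_at c zero = point -> path_at c one = point ->
  fiber_advance a s c = fiber_advance a' s' c.
Proof.
have E b r : collapsed b r -> path_at c zero = point -> path_at c one = point ->
    forall v t, path_at (path_at (fiber_advance b r c) v) t =
      run point 1 (approach point c) (Num.max (4 * val v - 3) (2 * val t - 1)).
  move=> br c0 c1 v t; have bs : sg (b, r) = point :> Y by exact: sg_pt.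
  rewrite fiber_advanceE ?c0 ?collapsed_loop // bs advance_flat //.
  by case: (collapsed_end br) => [[-> _]|]; [left|right].
move=> h1' h2 c0 c1; apply: fpath_eqP => v; apply: fpath_eqP => t.
by rewrite !E.
Qed.

Let fiber_rep (P : fiber p1 -> Prop) :
  (forall z a s, fib_base (fiber_incl p1 z) = sg (a, s) ->
     loop_at a s = path_at (fib_path (fiber_incl p1 z)) zero ->
     path_at (fib_path (fiber_incl p1 z)) one = point -> P z) ->
  forall z, P z.
Proof.
move=> HP z.
have [[a s] as_] : exists p, sg p = fib_base (fiber_incl p1 z).
  by move: (fib_base _); apply: Sg_ind => a s; exists (a, s).
apply: (HP z a s) => //; last exact: (fiber_inclP z).
by rewrite -fib_pathP -as_ ev_sg.
Qed.

Lemma ganea_to_first_stage :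
  exists g : ptmap G2 M,
    phomotopic R (ptcomp (realization_map R (Lambda R X) 1) g) (fib_proj R p').
Proof.
have cfb := @fib_base_continuous R Y X (ev R X).
have cfp := @fib_path_continuous R Y X (ev R X).
have [phi [cphi phiE]] := fiber_rec wX
  (fun K a s c chK ca cs cc ac c1 =>
     (fiber_contraction_continuous chK ca cs cc ac c1).1) fiber_contraction_collapsed.
have [psi [cpsi psiE]] := fiber_rec wX
  (fun K a s c chK ca cs cc ac c1 =>
     (fiber_advance_continuous ca cs cc ac).1) fiber_advance_collapsed.
pose b1 : ptmap G1 Y := @PtMap G1 Y (@fib_base R Y X (ev R X)) cfb erefl.
pose m1 : ptmap G1 M := ptcomp J (ptcomp squeeze b1).
have m1E g : m1 g = J (squeeze (fib_base g)) by [].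
have cphi2 : continuous (fun p : fiber p1 * I => path_at (phi p.1) p.2).
  apply: path_at_continuous; last by continuity.
  exact: (continuous_compose (@continuous_fst _ _ _ _ (@continuous_id _)) cphi).
have phi0 z : path_at (phi z) zero = m1 (fiber_incl p1 z).
  move: z; apply: fiber_rep => z a s zE ac c1.
  rewrite (phiE _ _ _ zE) fiber_contractionE // contraction_zero; last exact: end_map_loop.
  by rewrite m1E zE squeezeE.
have phi1 z : path_at (phi z) one = point.
  move: z; apply: fiber_rep => z a s zE ac c1.
  by rewrite (phiE _ _ _ zE) fiber_contractionE // contraction_one.
have pt_base : fib_base (fiber_incl p1 point) = sg (point : Om R X, zero) by [].
have pt_path t : path_at (fib_path (fiber_incl p1 point)) t = point by [].
have app_pt t : path_at (approach point (fib_path (fiber_incl p1 point))) t = point.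
  rewrite cat_pathE; last by rewrite pull_path1 pt_path pfun_pt.
  by rewrite pfun_pt !pt_path; case: ifP.
have pc : ev R X point = path_at (fib_path (fiber_incl p1 point)) zero.
  by rewrite pt_path pfun_pt.
have phi_pt t : path_at (phi point) t = point.
  rewrite (phiE _ _ _ pt_base) fiber_contractionE // contraction_flat //.
  - by rewrite lasso_cst ?pfun_pt.
  - exact: app_pt.
  - exact: app_pt.
  - by left; rewrite pfun_pt loop_sup_pt.
have [z t [->|->]|H [HG HC]] := @mcone_rec R _ _ (fiber_incl p1) M m1
  (fun z v => path_at (phi z) v) cphi2 phi0.
- exact: phi_pt.
- exact: phi1.
(* On the first Ganea space the homotopy runs along [approach]. It waits until
   [t = 1 / 2] because [advance] does so at [u = zero]. *)
pose late (g : G1) (t : I) : X :=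
  path_at (approach (fib_base g) (fib_path g)) (clamp (2 * val t - 1)).
have clate : continuous (fun q : G1 * I => late q.1 q.2).
  have cv2 : continuous (fun q : G1 * I => val q.2 : R) by apply: continuous_val; continuity.
  apply: path_at_continuous; last by continuity.
  apply: approach_continuous; [by continuity|by continuity|].
  by move=> q; exact: fib_pathP.
have lateE g t : path_at (mk_fpath (late g)) t = late g t.
  by apply: path_at_mk; exact: (curry_continuous (F := late) clate).2.
have late_pt : mk_fpath (late point) = point.
  by apply: fpath_eqP => t; rewrite lateE; exact: app_pt.
pose l1 : ptmap G1 (fpath R X) :=
  @PtMap G1 (fpath R X) _ (mk_fpath_continuous (F := late) clate) late_pt.
have l1E g t : path_at (l1 g) t = late g t by exact: lateE.
have cpsi2 : continuous (fun p : fiber p1 * I => path_at (psi p.1) p.2).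
  apply: path_at_continuous; last by continuity.
  exact: (continuous_compose (@continuous_fst _ _ _ _ (@continuous_id _)) cpsi).
have psi0 z : path_at (psi z) zero = l1 (fiber_incl p1 z).
  move: z; apply: fiber_rep => z a s zE ac c1; apply: fpath_eqP => t.
  rewrite (psiE _ _ _ zE) fiber_advanceE // l1E /late zE advance_u0 //.
  by rewrite approach0; [rewrite squeezeE ev_sg|rewrite ev_sg].
have psi1 z : path_at (psi z) one = point.
  move: z; apply: fiber_rep => z a s zE ac c1; apply: fpath_eqP => t.
  by rewrite (psiE _ _ _ zE) fiber_advanceE // advance_u1 // approach1 // ev_sg.
have psi_pt t : path_at (psi point) t = point.
  apply: fpath_eqP => v.
  rewrite (psiE _ _ _ pt_base) fiber_advanceE // advance_flat; last first.
    by left; rewrite pfun_pt.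
  by rewrite run_cst.
have [z t [->|->]|L [LG LC]] := @mcone_rec R _ _ (fiber_incl p1) (fpath R X) l1
  (fun z v => path_at (psi z) v) cpsi2 psi0.
- exact: psi_pt.
- exact: psi1.
have HL : phomotopic R (ptcomp (realization_map R (Lambda R X) 1) H) p'.
  have compE c : ptcomp (realization_map R (Lambda R X) 1) H c =
    realization_map R (Lambda R X) 1 (H c) by [].
  apply: (@phomotopic_of_paths R _ _ _ _ L); apply: mcone_ind => [g|z v].
  - rewrite LG l1E compE HG m1E realization_map_vertex -pull_path0 /late val_zero.
    rewrite clamp_le0; last by lra.
    by rewrite approach0 ?pull_path0 //; exact: fib_pathP.
  - rewrite LC compE HC; move: z; apply: fiber_rep => z a s zE ac c1.
    rewrite (psiE _ _ _ zE) fiber_advanceE // (phiE _ _ _ zE) fiber_contractionE //.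
    rewrite advance_t0 realization_map_contraction //.
    + exact: end_map_loop.
    + by rewrite approach1 // ev_sg.
    + by rewrite approach0; [rewrite squeezeE ev_sg|rewrite ev_sg].
  - rewrite LG l1E ganea_cone_map_base fib_projE /late val_one clamp_ge1; last by lra.
    by rewrite approach1 //; exact: fib_pathP.
  - rewrite LC ganea_cone_map_point; move: z; apply: fiber_rep => z a s zE ac c1.
    rewrite (psiE _ _ _ zE) fiber_advanceE // advance_t1 //.
    by rewrite approach1 // ev_sg.
have cb2 := @fib_base_continuous R C X p'.
pose b2 : ptmap G2 C := @PtMap G2 C (@fib_base R C X p') cb2 erefl.
exists (ptcomp H b2).
apply: (@phomotopic_trans R _ _ _ (ptcomp p' b2)); last exact: fib_path_homotopic.
exact: (phomotopic_precomp b2 HL).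
Qed.
End Assembly.

End FromGanea.

Theorem theorem2 (R : realType) (X : ptopologicalType) (hX : in_Top R X) :
  (exists f : ptmap (realization R (Lambda R X) 1) (ganea R X 2),
     phomotopic R (ptcomp (ganea_proj R X 2) f) (realization_map R (Lambda R X) 1)) /\
  (exists g : ptmap (ganea R X 2) (realization R (Lambda R X) 1),
     phomotopic R (ptcomp (realization_map R (Lambda R X) 1) g) (ganea_proj R X 2)).
Proof.
split; first exact: first_stage_to_ganea.
have [u [h [[cu ch] u01 u_pt [h0 h_pt] h1]]] := well_pointed_contraction (Top_wp hX).
exact: (ganea_to_first_stage cu ch u01 u_pt h0 h_pt h1 (Top_wh hX)).
Qed.
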